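(* Let $(G,+)$ be a compact topological group with a metric $d$ (inducing its topology), let $\sigma:\Omega\to\Omega$ be a topologically transitive two-sided subshift of finite type, let $\alpha\in(0,1]$, and let $f,g\in\mathcal{H}_\alpha(\Omega,\operatorname{Lip}(G))$. Suppose that $f$ and $g$ induce su-dominated cocycles over $\sigma$ and that for every $n\ge 1$ and every $x_0\in\Omega$ with $\sigma^n(x_0)=x_0$ one has $f^n_{x_0}=g^n_{x_0}$. Then there exist $\beta$ with $0<\beta<\alpha^2$ and a $\beta$-Hölder map $\phi:\Omega\to(\mathcal{H}_\beta(G),d_\infty)$, $x\mapsto\phi_x$, such that $$f_x=\phi_{\sigma(x)}\circ g_x\circ\phi_x^{-1}\qquad\text{for all }x\in\Omega.$$
   Context: Base. $P=(P_{i,j})_{1\le i,j\le k}$ is a matrix with entries in $\{0,1\}$ and no null row, $\Omega=\{(x_n)_{n\in\mathbb Z}\in\{1,\dots,k\}^{\mathbb Z}: P_{x_n,x_{n+1}}=1\ \forall n\in\mathbb Z\}$, and $\sigma((x_n)_n)=(x_{n+1})_n$. A constant $\rho>1$ is fixed and $d_\Omega(x,y)=\rho^{-N_{x,y}}$ with $N_{x,y}=\max\{N\ge 0: x_n=y_n\text{ for all }|n|<N\}$ (and $d_\Omega(x,x)=0$). Fibre maps. $\operatorname{Hom}(G)$ is the set of homeomorphisms of $G$ onto itself. $\mathcal{H}_\beta(G)\subset\operatorname{Hom}(G)$ is the set of $\beta$-Hölder homeomorphisms whose inverses are also $\beta$-Hölder; $\operatorname{Lip}(G)$ is the case $\beta=1$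 (bi-Lipschitz homeomorphisms). $d_\infty(u,v)=\sup_{p\in G}d(u(p),v(p))$. $L(u)$ denotes the (best) Lipschitz constant of $u$. The Lipschitz metric on $\operatorname{Lip}(G)$ is $d_1(u,v)=d_\infty(u,v)+L(u-v)$, where $u-v$ is the pointwise difference in $(G,+)$. Cocycles. $\mathcal{H}_\alpha(\Omega,\operatorname{Lip}(G))$ is the set of $\alpha$-Hölder maps $x\mapsto f_x$ from $(\Omega,d_\Omega)$ to $(\operatorname{Lip}(G),d_1)$. The induced cocycle has iterates $f^n_x=f_{\sigma^{n-1}(x)}\circ\cdots\circ f_x$ for $n\ge1$. Domination. The cocycle of $f\in\mathcal{H}_\alpha(\Omega,\operatorname{Lip}(G))$ is su-dominated if there is $\theta>0$ such that $L(f_x^{-1})<\rho^{\alpha-\theta}$ and $L(f_x)<\rho^{\alpha-\theta}$ for all $x\in\Omega$. *)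

(* Defs.v *)
From HB Require Import structures.
From mathcomp Require Import all_boot all_order all_algebra.
From mathcomp Require Import all_classical all_reals all_analysis.

Set Implicit Arguments.
Unset Strict Implicit.
Unset Printing Implicit Defensive.

Import Order.TTheory GRing.Theory Num.Theory.

Local Open Scope classical_set_scope.
Local Open Scope ring_scope.

(* Topological groups, not assumed commutative. The group law, written
   additively (G, +) in the mathematical text, is the multiplicative law of
   MathComp's [groupType]. *)
HB.mixin Record Group_isTopological G of Group G & Topological G := {
  mulg_continuous : continuous (fun p : G * G => (p.1 * p.2)%g) ;
  invg_continuous : continuous (fun p : G => (p^-1)%g)
}.

(* A topological group whose topology is the one induced by the metric
   [mdist]; no invariance of [mdist] under translations is required. *)
#[short(type="metricGroupType")]
HB.structure Definition MetricGroup (R : numDomainType) :=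
  { G of Metric R G & Group G & Group_isTopological G }.

Section Subshift.
Variables (R : realType) (k : nat) (P : 'M[bool]_k).

Definition sft : set (int -> 'I_k) :=
  [set x | forall n : int, P (x n) (x (n + 1))].

Fact sft_shift_subproof (x : sft) : (fun n : int => val x (n + 1)) \in sft.
Proof. by apply/mem_set => n; have /set_mem := valP x; apply. Qed.

Definition sft_shift (x : sft) : sft :=
  exist (fun z => z \in sft) _ (sft_shift_subproof x).

Definition agree (x y : sft) (N : nat) : Prop :=
  forall n : int, (absz n < N)%N -> val x n = val y n.

(* The maximum exists as soon as x <> y; the default value of [xget] is then
   never used. *)
Definition agree_max (x y : sft) : nat :=
  xget 0%N [set N | agree x y N /\ forall M, agree x y M -> (M <= N)%N].

Definition sft_dist (rho : R) (x y : sft) : R :=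
  if `[< x = y >] then 0 else rho ^- agree_max x y.

End Subshift.

Section MetricNotions.
Variable R : realType.

Definition metric_open (X : Type) (dX : X -> X -> R) (U : set X) : Prop :=
  forall x, U x -> exists2 e : R, 0 < e & forall y, dX x y < e -> U y.

(* Transitivity in forward time: with n ranging over all integers, shifts such
   as the one of the matrix (1 1; 0 1) would also qualify. *)
Definition topologically_transitive (X : Type) (dX : X -> X -> R)
    (T : X -> X) : Prop :=
  forall U V : set X, metric_open dX U -> metric_open dX V ->
    U !=set0 -> V !=set0 -> exists n : nat, (iter n T @` U) `&` V !=set0.

Definition holder (X Y : Type) (dX : X -> X -> R) (dY : Y -> Y -> \bar R)
    (a : R) (h : X -> Y) : Prop :=
  exists C : R, forall x y, (dY (h x) (h y) <= (C * dX x y `^ a)%:E)%E.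

End MetricNotions.

Section FibreMaps.
Variables (R : realType) (G : metricGroupType R).

Record homeo := Homeo {
  homeo_fun :> G -> G ;
  homeo_inv : G -> G ;
  homeo_funK : cancel homeo_fun homeo_inv ;
  homeo_invK : cancel homeo_inv homeo_fun ;
  homeo_fun_continuous : continuous homeo_fun ;
  homeo_inv_continuous : continuous homeo_inv
}.

Definition holder_fibre (b : R) (u : G -> G) : Prop :=
  holder (@mdist R G) (fun p q => (mdist p q)%:E) b u.

Definition holder_homeo (b : R) : set homeo :=
  [set u : homeo | holder_fibre b u /\ holder_fibre b (homeo_inv u)].

Definition lip_homeo : set homeo := holder_homeo 1.

Definition dist_sup (u v : G -> G) : \bar R :=
  ereal_sup (range (fun p => (mdist (u p) (v p))%:E)).

(* +oo when u is not Lipschitz. *)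
Definition lip_const (u : G -> G) : \bar R :=
  ereal_inf [set K%:E | K in
    [set K : R | 0 <= K /\
                 forall p q, mdist (u p) (u q) <= K * mdist p q]].

(* May be +oo on lip_homeo: the metric is arbitrary, so the difference of two
   Lipschitz maps need not be Lipschitz. *)
Definition dist_lip (u v : G -> G) : \bar R :=
  (dist_sup u v + lip_const (fun p => (u p * (v p)^-1)%g))%E.

End FibreMaps.

Section Cocycles.
Variables (R : realType) (k : nat) (P : 'M[bool]_k) (rho : R).
Variable G : metricGroupType R.

(* Membership in H_alpha(Omega, Lip(G)). *)
Definition holder_cocycle (alpha : R) (f : sft P -> homeo G) : Prop :=
  (forall x, lip_homeo (f x)) /\
  holder (sft_dist rho) (fun u v : homeo G => dist_lip u v) alpha f.

Fixpoint cocycle_iter (f : sft P -> homeo G) (n : nat) (x : sft P) : G -> G :=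
  if n is m.+1 then f (iter m (@sft_shift k P) x) \o cocycle_iter f m x else id.

Definition su_dominated (alpha : R) (f : sft P -> homeo G) : Prop :=
  exists2 theta : R, 0 < theta &
    forall x, (lip_const (homeo_inv (f x)) < (rho `^ (alpha - theta))%:E)%E /\
              (lip_const (f x) < (rho `^ (alpha - theta))%:E)%E.

End Cocycles.

(* Main.v *)
Require Import Defs.
From mathcomp Require Import all_boot all_order all_algebra.
From mathcomp Require Import zify lra ring.
From mathcomp Require Import all_classical all_reals all_analysis.

(** Domination makes the products [(f^n_y)^-1 o f^n_x] along asymptotic orbits
    converge geometrically fast to a holonomy; as these products are Lipschitz
    with exponentially growing constants, the holonomies are equi-Hölder by
    interpolation. Fix a periodic point [q], so that [f] and [g] have the same
    return map at [q]. For a point [z] homoclinic to the orbit of [q], the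
    products [f^n_{s^-n z} o (g^n_{s^-n z})^-1] and [(f^n_z)^-1 o g^n_z] then
    converge along the times at which [z] is in phase with [q]. The two limits
    coincide: closing up the orbit of [z] far out gives periodic points, where
    the products of [f] and [g] agree. Passing from [z] to a nearby point
    through the point with the past of one and the future of the other composes
    this common value [phi_z] with holonomies, whence [phi_z] is Hölder in the
    fibre, uniformly by comparison with one point per symbol, and Hölder in [z].
    By transitivity homoclinic points are dense, and [phi] extends to the whole
    subshift. *)

Set Implicit Arguments.
Unset Strict Implicit.
Unset Printing Implicit Defensive.

Import Order.TTheory GRing.Theory Num.Theory.

Local Open Scope classical_set_scope.
Local Open Scope ring_scope.

(** * Powers and geometric sequences *)

Section Powers.
Variable R : realType.
Implicit Types (b c k x y : R).

Lemma le_powR2r b x y : 0 <= b -> 0 <= x -> x <= y -> x `^ b <= y `^ b.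
Proof.
by move=> b0 x0 xy; apply: ge0_ler_powR; rewrite // nnegrE// (le_trans x0).
Qed.

Lemma powR_gt1 x b : 1 < x -> 0 < b -> 1 < x `^ b.
Proof.
move=> x1 b0; rewrite /powR gt_eqF ?(lt_trans _ x1)// -expR0 ltr_expR.
by rewrite mulr_gt0// ln_gt0.
Qed.

Lemma powR_exprn x b n : 0 <= x -> (x ^+ n) `^ b = (x `^ b) ^+ n.
Proof.
by move=> x0; rewrite -(powR_mulrn n x0) -(powR_mulrn n (powR_ge0 x b)) powRAC.
Qed.

Lemma powR_exprVn x b n : 0 <= x -> (x ^- n) `^ b = (x `^ (- b)) ^+ n.
Proof.
move=> x0; rewrite -exprVn powR_exprn ?invr_ge0// -(powR_inv1 x0) -powRrM.
by rewrite mulN1r.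
Qed.

Lemma powR_lt1 x b : 0 < x < 1 -> 0 < b -> x `^ b < 1.
Proof.
move=> /andP[x0 x1] b0; rewrite -[x]invrK -powR_inv1 ?invr_ge0 ?ltW//.
rewrite -powRrM mulN1r powRN invf_lt1 ?powR_gt0 ?invr_gt0//.
by rewrite powR_gt1 ?invf_gt1.
Qed.

Lemma exists_powR_eq x y : 0 < x <= y -> y < 1 ->
  exists b : R, [/\ 0 < b, b <= 1 & x `^ b = y].
Proof.
move=> /andP[x0 xy] y1; have y0 : 0 < y by exact: lt_le_trans xy.
have lny : ln y < 0 by rewrite ln_lt0// y0.
have lnxy : ln x <= ln y by rewrite ler_ln ?posrE.
have lnx : ln x < 0 by exact: le_lt_trans lny.
exists (ln y / ln x); split.
- by rewrite nmulr_lgt0 ?invr_lt0.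
- by rewrite ler_ndivrMr// mul1r.
- by rewrite /powR gt_eqF// divfK ?lnK ?lt_eqF.
Qed.

Lemma geometric_near_le c k x : 0 <= k < 1 -> 0 < x ->
  \forall n \near \oo, c * k ^+ n <= x.
Proof.
move=> /andP[k0 k1] x0; have : `|k| < 1 by rewrite ger0_norm.
move/(@cvg_geometric _ c)/cvgrPdist_le => /(_ _ x0); apply: filterS => n.
by rewrite /= sub0r normrN; apply: le_trans (ler_norm _).
Qed.

Lemma geometric_bracket k x : 0 < k < 1 -> 0 < x <= 1 ->
  exists n, k ^+ n.+1 < x <= k ^+ n.
Proof.
move=> /andP[k0 k1] /andP[x0 x1].
have ex : exists n, k ^+ n < x.
  have k01 : 0 <= k < 1 by rewrite ltW.
  have x2 : 0 < x / 2 by rewrite divr_gt0.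
  have [n] := filter_ex (geometric_near_le 1 k01 x2).
  by rewrite mul1r => kn; exists n; lra.
case: (ex_minnP ex) => -[|n] kn kmin; first by rewrite expr0 ltNge x1 in kn.
by exists n; rewrite kn leNgt; apply/negP => /kmin; rewrite ltnn.
Qed.

End Powers.

(** * Uniform convergence *)

Section UniformConvergence.
Variables (R : realType) (X : Type) (T : metricType R).
Implicit Types (u v w : X -> T) (us : nat -> X -> T) (e : R).

Definition uclose e u v := forall p, mdist (u p) (v p) <= e.

Definition ucvg us u :=
  forall e, 0 < e -> \forall n \near \oo, uclose e (us n) u.

Lemma uclose_refl u : uclose 0 u u.
Proof. by move=> p; rewrite mdistxx. Qed.

Lemma uclose_sym e u v : uclose e u v -> uclose e v u.
Proof. by move=> uv p; rewrite metric_sym. Qed.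

Lemma uclose_le e e' u v : e <= e' -> uclose e u v -> uclose e' u v.
Proof. by move=> ee' uv p; apply: le_trans ee'. Qed.

Lemma uclose_trans e e' v u w :
  uclose e u v -> uclose e' v w -> uclose (e + e') u w.
Proof.
by move=> uv vw p; apply: (le_trans (metric_triangle _ (v p) _)); apply: lerD.
Qed.

Lemma uclose_eq u v : (forall e, 0 < e -> uclose e u v) -> u = v.
Proof.
move=> uv; apply/funext => p; apply: mdist_positivity; apply/eqP.
rewrite eq_le mdist_ge0 andbT; apply/ler_addgt0Pr => e e0.
by rewrite add0r; exact: uv.
Qed.

Lemma ucvg_cst u : ucvg (fun=> u) u.
Proof.
by move=> e /ltW e0; apply: nearW => n; apply: uclose_le (uclose_refl u).
Qed.

Lemma ucvg_unique us u v : ucvg us u -> ucvg us v -> u = v.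
Proof.
move=> usu usv; apply: uclose_eq => e e0; rewrite [e]splitr.
have e2 : 0 < e / 2 by rewrite divr_gt0.
have [n [nu nv]] := filter_ex (filterI (usu _ e2) (usv _ e2)).
exact: uclose_trans (uclose_sym nu) nv.
Qed.

Lemma ucvg_subseq (s : nat -> nat) us u :
  s @ \oo --> \oo -> ucvg us u -> ucvg (us \o s) u.
Proof. by move=> s_oo usu e /usu; exact: s_oo. Qed.

Lemma ucvg_geometric c k us u : 0 <= k < 1 ->
  (forall n, uclose (c * k ^+ n) (us n) u) -> ucvg us u.
Proof.
move=> k01 usu e /(geometric_near_le c k01); apply: filterS => n.
by move/uclose_le; apply.
Qed.

End UniformConvergence.

Lemma uclose_compr (R : realType) (X Y : Type) (T : metricType R) (e : R)
    (u v : X -> T) (w : Y -> X) :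
  uclose e u v -> uclose e (u \o w) (v \o w).
Proof. by move=> uv p; exact: uv. Qed.

Lemma ucvg_compr (R : realType) (X Y : Type) (T : metricType R)
    (us : nat -> X -> T) u (w : Y -> X) :
  ucvg us u -> ucvg (fun n => us n \o w) (u \o w).
Proof. by move=> usu e /usu; apply: filterS => n; exact: uclose_compr. Qed.

Section CompactMetric.
Variables (R : realType) (T : metricType R).

Definition finite_diameter := exists D : R, forall p q : T, mdist p q <= D.

Hypothesis T_compact : compact [set: T].

Lemma compact_cluster_point (s : nat -> T) :
  exists c, forall e N, 0 < e -> exists2 n, (N <= n)%N & mdist c (s n) < e.
Proof.
have [c [_ sc]] : [set: T] `&` cluster (s x @[x --> \oo]) !=set0.
  by apply: T_compact; exact: filterT.
exists c => e N e0.
have [] := sc [set s n | n in [set n | (N <= n)%N]] (ball c e).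
- by exists N => //= n Nn; exists n.
- exact: nbhsx_ballx.
- by move=> _ [[n Nn <-]]; rewrite ballEmdist/= => cn; exists n.
Qed.

Lemma compact_finite_diameter : finite_diameter.
Proof.
have [[p0 _]|T0] := pselect ([set: T] !=set0); last first.
  by exists 0 => p; exfalso; apply: T0; exists p.
have /compact_near_coveringP := T_compact.
move=> /(_ _ +oo (fun D p => mdist p0 p <= D)) [p _|D [_ /(_ (D + 1))]].
  exists (ball p 1, [set D | mdist p0 p + 1 <= D]) => /=.
    by split; [exact: nbhsx_ballx|exact: nbhs_pinfty_ge (num_real _)].
  move=> [q D] /= []; rewrite ballEmdist /= => /ltW pq; apply: le_trans.
  by apply: (le_trans (metric_triangle _ p _)); rewrite lerD2l.
rewrite ltrDl => /(_ ltr01) p0_le; exists (D + 1 + (D + 1)) => p q.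
apply: (le_trans (metric_triangle _ p0 _)).
by rewrite lerD// ?(metric_sym p); exact: p0_le.
Qed.

Lemma geometric_ucvg (X : Type) (c k : R) (us : nat -> X -> T) :
  0 <= c -> 0 <= k < 1 -> (forall n, uclose (c * k ^+ n) (us n) (us n.+1)) ->
  exists u, forall n, uclose (c / (1 - k) * k ^+ n) (us n) u.
Proof.
move=> c0 /andP[k0 k1] us_step; have k1' : 0 < 1 - k by rewrite subr_gt0.
have us_tail n m :
    uclose (c / (1 - k) * (k ^+ n - k ^+ (n + m))) (us n) (us (n + m)%N).
  elim: m => [|m IH]; first by rewrite addn0 subrr mulr0; exact: uclose_refl.
  rewrite addnS; apply: uclose_le (uclose_trans IH (us_step _)).
  have -> : c * k ^+ (n + m) = c / (1 - k) * ((1 - k) * k ^+ (n + m)).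
    by rewrite mulrA divfK// gt_eqF.
  by rewrite -mulrDr exprS ler_wpM2l ?divr_ge0 ?(ltW k1')//; lra.
have /choice[u us_u] := fun p => compact_cluster_point (fun n => us n p).
exists u => n p; apply/ler_addgt0Pr => e e0.
have [m nm /ltW um] := us_u p e n e0.
apply: (le_trans (metric_triangle _ (us m p) _)); apply: lerD; last first.
  by rewrite metric_sym.
rewrite -(subnKC nm); apply: (le_trans (us_tail _ _ _)).
by rewrite ler_wpM2l ?divr_ge0 ?(ltW k1')// gerBl exprn_ge0.
Qed.

End CompactMetric.

Arguments finite_diameter {R} T.

(** * Equi-Hölder families *)

Section Holder.
Variables (R : realType) (T T' : metricType R).
Implicit Types (u : T -> T') (F : set (T -> T')) (A K b : R).

Definition lip_with K u := forall p q, mdist (u p) (u q) <= K * mdist p q.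

Definition holder_with A b u :=
  forall p q, mdist (u p) (u q) <= A * mdist p q `^ b.

Definition equi_holder F := exists b A : R,
  [/\ 0 < b, b <= 1, 0 <= A & forall u, F u -> holder_with A b u].

Lemma lip_with_le K K' u : K <= K' -> lip_with K u -> lip_with K' u.
Proof.
move=> KK' uK p q; apply: (le_trans (uK p q)).
by rewrite ler_wpM2r// mdist_ge0.
Qed.

Lemma lip_with_uclose (X : Type) K e u (v w : X -> T) : 0 <= K ->
  lip_with K u -> uclose e v w -> uclose (K * e) (u \o v) (u \o w).
Proof.
by move=> K0 uK vw p; apply: (le_trans (uK _ _)); rewrite ler_wpM2l.
Qed.

Lemma holder_with_uclose (X : Type) A b e u (v w : X -> T) : 0 <= A -> 0 <= b ->
  holder_with A b u -> uclose e v w -> uclose (A * e `^ b) (u \o v) (u \o w).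
Proof.
move=> A0 b0 uA vw p; apply: (le_trans (uA _ _)); rewrite ler_wpM2l//.
by apply: le_powR2r => //; exact: mdist_ge0.
Qed.

Lemma holder_with_le A A' b u :
  A <= A' -> holder_with A b u -> holder_with A' b u.
Proof.
move=> AA' uA p q; apply: (le_trans (uA p q)).
by rewrite ler_wpM2r// powR_ge0.
Qed.

Lemma holder_with_ucvg A b us u :
  ucvg us u -> (forall n, holder_with A b (us n)) -> holder_with A b u.
Proof.
move=> usu usA p q; apply/ler_addgt0Pr => e e0.
have e2 : 0 < e / 2 by rewrite divr_gt0.
have [n un] := filter_ex (usu _ e2).
have := usA n p q; have := un p; have := un q.
have := metric_triangle (u p) (us n p) (u q).
have := metric_triangle (us n p) (us n q) (u q).
rewrite (metric_sym (u p) (us n p)); lra.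
Qed.

Lemma finite_diameter_holder_exponent : finite_diameter T ->
  exists2 D : R, 0 <= D & forall A b b' u,
    0 <= A -> 0 < b' -> b' <= b -> b <= 1 ->
    holder_with A b u -> holder_with (A * D) b' u.
Proof.
case=> D TD; exists (Num.max 1 D) => [|A b b' u A0 b'0 b'b b1 uA p q].
  by rewrite le_max ler01.
apply: (le_trans (uA p q)); rewrite -mulrA ler_wpM2l//.
have -> : mdist p q `^ b = mdist p q `^ (b - b') * mdist p q `^ b'.
  by rewrite -powRD subrK// gt_eqF// (lt_le_trans b'0).
rewrite ler_wpM2r ?powR_ge0//.
apply: (@le_trans _ _ (Num.max 1 D `^ (b - b'))).
  by apply: le_powR2r; rewrite ?subr_ge0 ?mdist_ge0// le_max TD orbT.
rewrite -[leRHS]powRr1 ?le_max ?ler01//.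
by apply: ler_powR; rewrite ?le_max ?lexx//; lra.
Qed.

Lemma equi_holder_sub F F' : F `<=` F' -> equi_holder F' -> equi_holder F.
Proof.
move=> FF' [b [A [b0 b1 A0 F'A]]]; exists b, A; split=> // u /FF'.
exact: F'A.
Qed.

Lemma equi_holder_lip K F : 0 <= K -> (forall u, F u -> lip_with K u) ->
  equi_holder F.
Proof.
move=> K0 FK; exists 1, K; split=> // u /FK uK p q.
by rewrite powRr1 ?mdist_ge0.
Qed.

Lemma equi_holder_equicontinuous F e : equi_holder F -> 0 < e ->
  exists2 d : R, 0 < d & forall (X : Type) u (v w : X -> T),
    F u -> uclose d v w -> uclose e (u \o v) (u \o w).
Proof.
move=> [b [A [b0 b1 A0 FA]]] e0; exists ((e / (A + 1)) `^ b^-1).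
  by rewrite powR_gt0// divr_gt0// ltr_wpDl.
move=> X u v w /FA uA /(holder_with_uclose A0 (ltW b0) uA); apply: uclose_le.
rewrite -powRrM mulVf ?gt_eqF// powRr1; last first.
  by rewrite divr_ge0 ?ltW// ltr_wpDl.
rewrite mulrCA -[leRHS]mulr1 ler_wpM2l ?(ltW e0)//.
by rewrite ler_pdivrMr ?ltr_wpDl// mul1r lerDl.
Qed.

Lemma equi_holder_continuous F u : equi_holder F -> F u -> continuous u.
Proof.
move=> F_holder Fu p; apply/cvg_ballP => e e0.
have e2 : 0 < e / 2 by rewrite divr_gt0.
have [d d0 F_cont] := equi_holder_equicontinuous F_holder e2.
apply: filterS (nbhsx_ballx p d d0) => p'; rewrite !ballEmdist /= => /ltW pp'.
have /(_ tt) := F_cont unit u (fun=> p) (fun=> p') Fu (fun=> pp').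
by move=> /le_lt_trans; apply; lra.
Qed.

Lemma equi_holder_bigcup (I : finType) (Fs : I -> set (T -> T')) :
  finite_diameter T -> (forall i, equi_holder (Fs i)) ->
  equi_holder (\bigcup_i Fs i).
Proof.
case/finite_diameter_holder_exponent => D D0 lower_exponent.
move=> /choice[b /choice[A FsA]].
pose b' := \big[Num.min/1]_i b i; pose A' := \sum_i A i * D.
have AD0 i : 0 <= A i * D by rewrite mulr_ge0//; case: (FsA i).
exists b', A'; split=> [|||u [i _ Fsu]]; rewrite ?bigmin_le_id ?sumr_ge0//.
  by apply: lt_bigmin => // i _; case: (FsA i).
have [b0 b1 A0 /(_ u Fsu) uA] := FsA i.
apply: (@holder_with_le (A i * D)).
  by rewrite /A' (bigD1 i)//= lerDl sumr_ge0.
apply: lower_exponent uA => //; last exact: bigmin_le.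
by apply: lt_bigmin => // j _; case: (FsA j).
Qed.

(* At scale [d] the Lipschitz bound [K M^n d] and the uniform error [c l^n]
   balance for [(l/M)^n ~ d], and [(l/M)^b = l]. *)
Lemma equi_holder_interpolation (M l c K : R) : finite_diameter T' ->
  1 < M -> 0 < l < 1 -> 0 <= c -> 0 <= K ->
  equi_holder [set u | exists us, forall n,
    uclose (c * l ^+ n) (us n) u /\ lip_with (K * M ^+ n) (us n)].
Proof.
move=> [D T'D] M1 /andP[l0 l1] c0 K0.
have M0 : 0 < M by rewrite (lt_trans _ M1).
pose k := l / M; pose E := (c + c + K) / l.
have k0 : 0 < k by rewrite divr_gt0.
have kl : k <= l by rewrite ler_piMr ?(ltW l0)// invf_le1 ?ltW.
have k0l : 0 < k <= l by rewrite k0.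
have [b [b0 b1 kb]] := exists_powR_eq k0l l1.
have E0 : 0 <= E by rewrite divr_ge0 ?addr_ge0// ltW.
have ED : E <= E + Num.max 0 D by rewrite lerDl le_max lexx.
exists b, (E + Num.max 0 D); split=> //; first exact: le_trans ED.
move=> u [us usu] p q; set d := mdist p q.
have d_ge0 : 0 <= d by exact: mdist_ge0.
have [d1|d1] := leP 1 d.
  apply: (le_trans (T'D _ _)); apply: (@le_trans _ _ (E + Num.max 0 D)).
    by rewrite -[leLHS]add0r lerD// le_max lexx orbT.
  rewrite ler_peMr ?(le_trans E0)// -(powRr0 d); apply: ler_powR => //.
  exact: ltW.
have [pq|pq] := eqVneq p q.
  by rewrite pq mdistxx mulr_ge0 ?powR_ge0// (le_trans E0).
have [||n /andP[knd dkn]] := @geometric_bracket _ k d.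
- by rewrite k0 (le_lt_trans kl).
- by rewrite mdist_gt0 pq ltW.
have Mdl : M ^+ n * d <= l ^+ n.
  by move: dkn; rewrite expr_div_n ler_pdivlMr ?exprn_gt0// mulrC.
have ldb : l ^+ n <= d `^ b / l.
  rewrite ler_pdivlMr// -exprSr -kb -powR_exprn ?(ltW k0)//.
  by apply: le_powR2r; rewrite ?exprn_ge0 ?(ltW b0) ?(ltW k0) ?(ltW knd).
apply: (@le_trans _ _ (E * d `^ b)); last by rewrite ler_wpM2r ?powR_ge0.
apply: (@le_trans _ _ ((c + c + K) * l ^+ n)); last first.
  by rewrite /E mulrAC -mulrA ler_wpM2l// !addr_ge0.
have [/[dup]/(_ p) up /(_ q) uq /(_ p q)] := usu n; rewrite -mulrA -/d => usK.
have : K * (M ^+ n * d) <= K * l ^+ n by rewrite ler_wpM2l.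
have := metric_triangle (u p) (us n p) (u q).
have := metric_triangle (us n p) (us n q) (u q).
rewrite (metric_sym (u p) (us n p)) !mulrDl; lra.
Qed.

End Holder.

Section HolderComposition.
Variables (R : realType) (T T' T'' : metricType R).
Implicit Types (u : T' -> T'') (v : T -> T').

Lemma lip_with_comp K K' u v : 0 <= K -> lip_with K u -> lip_with K' v ->
  lip_with (K * K') (u \o v).
Proof.
move=> K0 uK vK' p q; apply: (le_trans (uK _ _)).
by rewrite -mulrA ler_wpM2l.
Qed.

Lemma equi_holder_comp (F : set (T' -> T'')) (F' : set (T -> T')) :
  equi_holder F -> equi_holder F' ->
  equi_holder [set u \o v | u in F & v in F'].
Proof.
move=> [b [A [b0 b1 A0 FA]]] [b' [A' [b'0 b'1 A'0 F'A']]].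
exists (b' * b), (A * A' `^ b); split; rewrite ?mulr_gt0 ?mulr_ge0 ?powR_ge0//.
  by apply: mulr_ile1 => //; exact: ltW.
move=> _ [u /FA uA [v /F'A' vA' <-]] p q; apply: (le_trans (uA _ _)).
rewrite -mulrA ler_wpM2l// powRrM -powRM ?powR_ge0//.
by apply: le_powR2r; rewrite ?(ltW b0)// mdist_ge0.
Qed.

Lemma ucvg_comp (X : Type) (F : set (T' -> T'')) us u (ws : nat -> X -> T') w :
  equi_holder F -> F u -> ucvg us u -> ucvg ws w ->
  ucvg (fun n => us n \o ws n) (u \o w).
Proof.
move=> F_holder Fu usu wsw e e0; have e2 : 0 < e / 2 by rewrite divr_gt0.
have [d d0 F_cont] := equi_holder_equicontinuous F_holder e2.
apply: filterS2 (usu _ e2) (wsw _ d0) => n un wn; rewrite [e]splitr.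
exact: uclose_trans (uclose_compr _ un) (F_cont _ _ _ _ Fu wn).
Qed.

End HolderComposition.

Lemma ucvg_conj_eq (R : realType) (T : metricType R)
    (F : set (T -> T)) us vs (u v : T -> T) :
  equi_holder F -> F v -> ucvg us u -> ucvg vs v ->
  (forall d : R, 0 < d -> \forall j \near \oo, exists h k,
    [/\ us j = h \o vs j \o k, uclose d h id & uclose d k id]) ->
  u = v.
Proof.
move=> F_holder Fv usu vsv us_vs; apply: uclose_eq => e e0.
have e4 : 0 < e / 4 by rewrite divr_gt0.
have [d d0 F_cont] := equi_holder_equicontinuous F_holder e4.
have m0 : 0 < Num.min d (e / 4) by rewrite lt_min d0.
have [j [[uj vj] [h [k [E hid kid]]]]] :=
  filter_ex (filterI (filterI (usu _ e4) (vsv _ e4)) (us_vs _ m0)).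
have {}hid : uclose (e / 4) h id.
  by apply: uclose_le hid; rewrite ge_min lexx orbT.
have {}kid : uclose d k id by apply: uclose_le kid; rewrite ge_min lexx.
rewrite E in uj; have -> : e = e / 4 + (e / 4 + (e / 4 + e / 4)) by lra.
apply: (uclose_trans (uclose_sym uj)).
apply: (uclose_trans (uclose_compr (vs j \o k) hid)).
apply: (uclose_trans (uclose_compr k vj)).
exact: (F_cont _ _ _ id Fv kid).
Qed.

(** * Holonomies of non-autonomous products *)

Section Products.
Variables (R : realType) (G : metricGroupType R).
Implicit Types (h k : homeo G) (a b c d : nat -> homeo G) (M e : R).

Lemma homeo_eq h k : homeo_fun h = homeo_fun k -> h = k.
Proof.
case: h k => [h h' hK h'K hc h'c] [k k' kK k'K kc k'c] /= hk.
have h'k' : h' = k' by apply/funext => p; rewrite -{1}(k'K p) -hk hK.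
by subst k k'; congr Homeo; exact: Prop_irrelevance.
Qed.

Definition homeo_id : homeo G :=
  @Homeo _ _ id id (fun=> erefl) (fun=> erefl)
    (fun p => @cvg_id _ (nbhs p)) (fun p => @cvg_id _ (nbhs p)).

Definition homeo_sym h : homeo G :=
  Homeo (homeo_invK h) (homeo_funK h)
    (@homeo_inv_continuous _ _ h) (@homeo_fun_continuous _ _ h).

Definition homeo_comp h k : homeo G :=
  Homeo (can_comp (homeo_funK h) (homeo_funK k))
    (can_comp (homeo_invK k) (homeo_invK h))
    (fun p => continuous_comp (@homeo_fun_continuous _ _ k p)
                (@homeo_fun_continuous _ _ h _))
    (fun p => continuous_comp (@homeo_inv_continuous _ _ h p)
                (@homeo_inv_continuous _ _ k _)).

Fixpoint comp_seq a n : homeo G :=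
  if n is m.+1 then homeo_comp (a m) (comp_seq a m) else homeo_id.

Definition holo a b n : G -> G := homeo_inv (comp_seq a n) \o comp_seq b n.

Lemma comp_seqD a n m :
  comp_seq a (n + m) =
  homeo_comp (comp_seq (fun i => a (n + i)%N) m) (comp_seq a n).
Proof.
elim: m => [|m IH]; first by rewrite addn0; exact: homeo_eq.
by rewrite addnS /= IH; exact: homeo_eq.
Qed.

Lemma holo_id a n : holo a a n = id.
Proof. by apply/funext; exact: homeo_funK. Qed.

Lemma holo_comp b a c n : holo a b n \o holo b c n = holo a c n.
Proof. by apply/funext => p; rewrite /holo /= homeo_invK. Qed.

Lemma holo_conj a' b' c' d' a b c d n m : holo a' b' n = holo c' d' m ->
  holo a b n = (holo a a' n \o holo c' c m) \o holo c d m
    \o (holo d d' m \o holo b' b n).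
Proof.
move=> a'b'; rewrite -(holo_comp a' a b) -(holo_comp b' a' b) a'b'.
by rewrite -(holo_comp c c' d') -(holo_comp d c d').
Qed.

Lemma holoD a b n m : holo a b (n + m) =
  homeo_inv (comp_seq a n)
    \o holo (fun i => a (n + i)%N) (fun i => b (n + i)%N) m \o comp_seq b n.
Proof. by rewrite /holo !comp_seqD. Qed.

Definition bilip M h := lip_with M h /\ lip_with M (homeo_inv h).

Lemma bilip_comp_seq M a n : 0 <= M -> (forall i, bilip M (a i)) ->
  bilip (M ^+ n) (comp_seq a n).
Proof.
move=> M0 aM; elim: n => [|n [IH IH']].
  by split=> p q; rewrite mul1r.
have [aMn aMn'] := aM n; split; first by rewrite exprS; exact: lip_with_comp.
by rewrite exprSr; apply: lip_with_comp; rewrite ?exprn_ge0.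
Qed.

Lemma lip_with_holo M a b n : 0 <= M ->
  (forall i, bilip M (a i)) -> (forall i, bilip M (b i)) ->
  lip_with ((M * M) ^+ n) (holo a b n).
Proof.
move=> M0 aM bM; rewrite exprMn; apply: lip_with_comp; rewrite ?exprn_ge0//.
  by case: (bilip_comp_seq n M0 aM).
by case: (bilip_comp_seq n M0 bM).
Qed.

Lemma uclose_homeo_inv M e h k : 0 <= M -> bilip M h -> uclose e h k ->
  uclose (M * e) (homeo_inv h) (homeo_inv k).
Proof.
move=> M0 [_ hM] hk p.
have := lip_with_uclose M0 hM (uclose_sym hk) (homeo_inv k p).
by rewrite /= homeo_funK homeo_invK.
Qed.

Lemma holo_step M a b e n : 0 <= M -> (forall i, bilip M (a i)) ->
  uclose e (a n) (b n) -> uclose (M ^+ n.+1 * e) (holo a b n) (holo a b n.+1).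
Proof.
move=> M0 aM /(lip_with_uclose M0 (aM n).2) abn; rewrite exprSr -mulrA.
have Mn0 : 0 <= M ^+ n by rewrite exprn_ge0.
have [_ /(lip_with_uclose Mn0)] := bilip_comp_seq n M0 aM.
move=> /(_ _ _ _ _ abn)/(uclose_compr (comp_seq b n)) => h p.
by have := h p; rewrite /holo /= homeo_funK.
Qed.

End Products.

Section Domination.
Variables (R : realType) (G : metricGroupType R) (M t : R).
Hypotheses (M_gt1 : 1 < M) (t_gt0 : 0 < t) (Mt_lt1 : M * t < 1).
Implicit Types (a b : nat -> homeo G) (c : R).

Let M_ge0 : 0 <= M. Proof. by rewrite ltW// (lt_trans _ M_gt1). Qed.
Let Mt01 : 0 < M * t < 1.
Proof. by rewrite mulr_gt0 ?(lt_trans _ M_gt1). Qed.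
Let t_lt1 : t < 1.
Proof. by apply: lt_trans Mt_lt1; rewrite ltr_pMl. Qed.

(* [a i] and [b i] drift apart as [i] increases, so that the last factors
   dominate the bound. *)
Lemma holo_uclose_id a b c r n : 0 <= c -> (forall i, bilip M (a i)) ->
  (forall i, (i < n)%N -> uclose (c * t ^+ (r + (n - i))) (a i) (b i)) ->
  uclose (c * M / (1 - t) * M ^+ n * t ^+ r) (holo a b n) id.
Proof.
move=> c0 aM; have t1 : 0 < 1 - t by rewrite subr_gt0.
elim: n r => [|n IH] r ab.
  apply: uclose_le (uclose_refl _).
  by rewrite !mulr_ge0 ?invr_ge0 ?exprn_ge0 ?(ltW t1) ?(ltW t_gt0).
have near_id : uclose (c * M / (1 - t) * M ^+ n * t ^+ r.+1) (holo a b n) id.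
  apply: IH => i ni; apply: uclose_le (ab i (ltnW ni)).
  by rewrite subSn ?(ltnW ni)// addnS.
have := ab n (leqnn _); rewrite subSnn => /(holo_step M_ge0 aM) step.
apply: uclose_le (uclose_trans (uclose_sym step) near_id).
rewrite addn1 !exprS; set x := M ^+ n; set y := t ^+ r.
have x0 : 0 <= x by rewrite exprn_ge0.
have y0 : 0 <= y by rewrite exprn_ge0 ?ltW.
rewrite -subr_ge0 [leRHS](_ : _ = c * M * x * y / (1 - t) *
    ((M - 1) + (1 - t) * (1 - t))); last by field; rewrite gt_eqF.
rewrite !mulr_ge0 ?invr_ge0 ?(ltW t1)// addr_ge0 ?mulr_ge0 ?(ltW t1)//.
by rewrite subr_ge0 ltW.
Qed.

Definition holonomies c : set (G -> G) := [set h | exists a b,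
  [/\ forall i, bilip M (a i), forall i, bilip M (b i) &
      forall n, uclose (c * M / (1 - M * t) * (M * t) ^+ n) (holo a b n) h]].

Lemma holonomies_uclose_id c h : holonomies c h ->
  uclose (c * M / (1 - M * t)) h id.
Proof.
by move=> [a [b [_ _ /(_ 0%N)]]]; rewrite expr0 mulr1; exact: uclose_sym.
Qed.

Hypothesis G_compact : compact [set: G].

Lemma holo_ucvg c a b : 0 <= c ->
  (forall i, bilip M (a i)) -> (forall i, bilip M (b i)) ->
  (forall i, uclose (c * t ^+ i) (a i) (b i)) ->
  exists2 h, holonomies c h & ucvg (holo a b) h.
Proof.
move=> c0 aM bM ab; have cM0 : 0 <= c * M by rewrite mulr_ge0.
have Mt01' : 0 <= M * t < 1 by case/andP: Mt01 => /ltW ->.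
have [n|h ab_h] := geometric_ucvg G_compact (us := holo a b) cM0 Mt01'.
  have := holo_step M_ge0 aM (ab n); apply: uclose_le.
  by rewrite exprMn exprS le_eqVlt; apply/orP; left; apply/eqP; ring.
by exists h; [exists a, b|exact: ucvg_geometric ab_h].
Qed.

Lemma equi_holder_holonomies c : 0 <= c -> equi_holder (holonomies c).
Proof.
move=> c0; have MM_gt1 : 1 < M * M by rewrite -[ltLHS]mulr1 ltr_pM.
have k0 : 0 <= c * M / (1 - M * t).
  by rewrite !mulr_ge0// invr_ge0 subr_ge0 ltW.
apply: equi_holder_sub (equi_holder_interpolation G
  (compact_finite_diameter G_compact) MM_gt1 Mt01 k0 ler01).
move=> h [a [b [aM bM ab]]]; exists (holo a b) => n; split=> //.
by rewrite mul1r; exact: lip_with_holo.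
Qed.

End Domination.

(** * Subshifts of finite type *)

Section Subshift.
Variables (k : nat) (P : 'M[bool]_k).
Implicit Types (x y z w q p : sft P) (i j : int) (s : bool) (l m n J N : nat).

Lemma sft_admissible x i : P (val x i) (val x (i + 1)).
Proof. by have /set_mem := valP x; apply. Qed.

Definition sft_mk (c : int -> 'I_k) (c_path : forall i, P (c i) (c (i + 1))) :
  sft P := exist (fun s : int -> 'I_k => s \in sft P) c (mem_set c_path).

Lemma sft_ext x y : (forall i, val x i = val y i) -> x = y.
Proof. by move=> xy; apply: val_inj; apply/funext. Qed.

Fact sft_translate_subproof j x i : P (val x (i + j)) (val x (i + 1 + j)).
Proof. by rewrite addrAC; exact: sft_admissible. Qed.

Definition sft_translate j x : sft P := sft_mk (sft_translate_subproof j x).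

Lemma sft_translateE j x i : val (sft_translate j x) i = val x (i + j).
Proof. by []. Qed.

Lemma sft_translateD i j x :
  sft_translate i (sft_translate j x) = sft_translate (i + j) x.
Proof. by apply: sft_ext => n; rewrite !sft_translateE addrA. Qed.

Lemma sft_translate0 x : sft_translate 0 x = x.
Proof. by apply: sft_ext => i; rewrite sft_translateE addr0. Qed.

Lemma sft_shiftE x : sft_shift x = sft_translate 1 x.
Proof. exact: sft_ext. Qed.

Lemma iter_sft_shift n x :
  iter n (@sft_shift k P) x = sft_translate n x.
Proof.
elim: n => [|n IH]; first by rewrite sft_translate0.
by rewrite iterS IH sft_shiftE sft_translateD; congr sft_translate; lia.
Qed.

Lemma sft_translate_muln l q n :
  sft_translate l q = q -> sft_translate (n * l)%N q = q.
Proof.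
move=> ql; elim: n => [|n IH]; first by rewrite mul0n sft_translate0.
by rewrite mulSn PoszD -sft_translateD IH.
Qed.

Lemma sft_glue x y : val x 0 = val y 0 -> exists z,
  (forall i, i <= 0 -> val z i = val x i) /\
  (forall i, 0 <= i -> val z i = val y i).
Proof.
move=> xy; pose c i := if (i <= 0) then val x i else val y i.
have c_path i : P (c i) (c (i + 1)).
  rewrite /c; case: ifP => i0; case: ifP => i1; try exact: sft_admissible.
    have -> : i = 0 by lia.
    by rewrite xy; exact: sft_admissible.
  lia.
exists (sft_mk c_path); split => i i0 /=; first by rewrite /c i0.
rewrite /c; case: ifP => // i0'; have -> : i = 0 by lia.
exact: xy.
Qed.

Lemma sft_periodize w l : (0 < l)%N -> val w 0 = val w l -> exists z,
  sft_translate l z = z /\ forall i, 0 <= i <= l%:Z -> val z i = val w i.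
Proof.
move=> l_gt0 w0l; pose c i := val w (i %% l)%Z.
have l0 : l%:Z != 0 by lia.
have c_path i : P (c i) (c (i + 1)).
  rewrite /c -modzDml; have := modz_ge0 i l0; have := @ltz_pmod i l l_gt0.
  set j := (i %% l)%Z => jl j0; have [e|ne] := eqVneq (j + 1) l%:Z.
    by rewrite e modzz w0l -e; exact: sft_admissible.
  by rewrite modz_small; [exact: sft_admissible|lia].
exists (sft_mk c_path); split => [|i /andP[i0 il]].
  by apply: sft_ext => i /=; rewrite /c modzDr.
rewrite /= /c; have [->|ne] := eqVneq i l%:Z; first by rewrite modzz.
by rewrite modz_small//; lia.
Qed.

Lemma sft_periodic_point x :
  exists q l, (0 < l)%N /\ sft_translate l q = q.
Proof.
have /injectivePn : ~~ injectiveb (fun i : 'I_k.+1 => val x (i : nat)%:Z).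
  by apply/negP => /injectiveP /leq_card; rewrite !card_ord ltnn.
move=> [i [j ij e]]; wlog lt_ij : i j ij e / (i < j)%N => [wlog_lt|].
  have [lt|lt|eq] := ltngtP (i : nat) j; first exact: (wlog_lt i j).
    by apply: (wlog_lt j i) => //; rewrite eq_sym.
  by rewrite (val_inj eq) eqxx in ij.
have [||q [ql _]] := @sft_periodize (sft_translate (i : nat) x) (j - i)%N.
- by rewrite subn_gt0.
- by rewrite !sft_translateE add0r e; congr (val x _); lia.
by exists q, (j - i)%N; rewrite subn_gt0.
Qed.

Lemma agree_mono x y N N' : (N' <= N)%N -> agree x y N -> agree x y N'.
Proof. by move=> N'N xy n nN'; apply: xy; exact: leq_trans nN' N'N. Qed.

Lemma agree_sym x y N : agree x y N -> agree y x N.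
Proof. by move=> xy n /xy. Qed.

Lemma agree_trans y x z N : agree x y N -> agree y z N -> agree x z N.
Proof. by move=> xy yz n nN; rewrite xy// yz. Qed.

Lemma agree_translate1 x y N : agree x y N.+1 ->
  agree (sft_translate 1 x) (sft_translate 1 y) N.
Proof. by move=> xy i iN; rewrite !sft_translateE; apply: xy; lia. Qed.

(* [s] is a direction of time: [true] for the future, [false] for the past. *)
Definition time s i : int := if s then i else - i.

Definition half_agree s N x y :=
  forall i, - N%:Z < time s i -> val x i = val y i.

Lemma half_agree_sym s N x y : half_agree s N x y -> half_agree s N y x.
Proof. by move=> xy i /xy. Qed.

Lemma half_agree_mono s N N' x y :
  (N' <= N)%N -> half_agree s N x y -> half_agree s N' x y.
Proof. by move=> N'N xy i iN'; apply: xy; lia. Qed.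

Lemma half_agree_bracket x y N : agree x y N.+1 ->
  exists z, half_agree false N.+1 x z /\ half_agree true N.+1 y z.
Proof.
move=> xy; have [|z [zx zy]] := @sft_glue x y; first exact: xy.
exists z; split=> i /= iN; have [i0|i0] := leP i 0.
- by rewrite zx.
- by rewrite zy ?xy//; lia.
- by rewrite zx -?xy//; lia.
- by rewrite zy// ltW.
Qed.

Definition asymptotic q s z n :=
  half_agree s 0 (sft_translate (time s n) z) q.

Definition homoclinic q z := forall s, exists n, asymptotic q s z n.

Lemma asymptotic_half_agree q s x y n :
  half_agree s 0 x y -> asymptotic q s x n -> asymptotic q s y n.
Proof.
move=> xy xn i i0; rewrite -xn// !sft_translateE xy//.
by case: s i0 {xy xn} => /=; lia.
Qed.

Lemma homoclinic_bracket q x y z : half_agree false 0 x z ->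
  half_agree true 0 y z -> homoclinic q x -> homoclinic q y -> homoclinic q z.
Proof.
move=> xz yz x_hom y_hom [].
  by have [n yn] := y_hom true; exists n; exact: asymptotic_half_agree yz yn.
by have [n xn] := x_hom false; exists n; exact: asymptotic_half_agree xz xn.
Qed.

Lemma homoclinic_translate1 q l z : (0 < l)%N -> sft_translate l q = q ->
  homoclinic q z -> homoclinic q (sft_translate 1 z).
Proof.
move=> l0 ql z_hom []; have [n zn] := z_hom true.
  exists (n + l).-1 => i /= i0; rewrite -ql !sft_translateE.
  rewrite -zn; last by rewrite /=; lia.
  by rewrite sft_translateE; congr (val z _); rewrite /=; lia.
have [m zm] := z_hom false; exists m.+1 => i i0; rewrite -zm//.
by rewrite !sft_translateE; congr (val z _); rewrite /=; lia.
Qed.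

(* The periodic point repeats the word that [z] spells from [-(n + J)] to
   [m + J]: both ends of this word lie on the orbit of [q], in phase. *)
Lemma homoclinic_closing q z n m J : (0 < J)%N -> sft_translate J q = q ->
  asymptotic q false z n -> asymptotic q true z m ->
  exists p, sft_translate (n + J + (m + J))%N p = p /\ agree z p (J + J).
Proof.
move=> J0 qJ zn zm; pose L := (n + J + (m + J))%N.
have val_qJ i : val q (i + J%:Z) = val q i by rewrite -sft_translateE qJ.
have past i : i < 0 -> val z (i - n%:Z) = val q i.
  by move=> i0; rewrite -zn//=; lia.
have future i : 0 < i -> val z (i + m%:Z) = val q i by move=> i0; rewrite -zm.
have [||p0 [p0L p0z]] := @sft_periodize (sft_translate (- (n + J)%N%:Z) z) L.
- by rewrite /L; lia.
- have -> : - (n + J)%N%:Z = - J%:Z - n%:Z by lia.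
  rewrite !sft_translateE add0r past; last by lia.
  have -> : L%:Z + (- J%:Z - n%:Z) = J%:Z + m%:Z by rewrite /L; lia.
  by rewrite future; [rewrite -(val_qJ (- J%:Z)) addNr -(val_qJ 0) add0r|lia].
pose p := sft_translate (n + J)%N p0.
have pL : sft_translate L p = p.
  by rewrite /p sft_translateD addrC -sft_translateD p0L.
have val_pL i : val p (i + L%:Z) = val p i by rewrite -sft_translateE pL.
have pz i : - (n + J)%N%:Z <= i <= (m + J)%N%:Z -> val p i = val z i.
  move=> iJ; rewrite /p sft_translateE p0z; last by rewrite /L; lia.
  by rewrite sft_translateE; congr (val z _); lia.
exists p; split=> // i iJ; have [i1|i1] := ltP i (- (n + J)%N%:Z).
  rewrite -val_pL pz; last by rewrite /L; lia.
  have -> : i + L%:Z = (i + n%:Z + J%:Z + J%:Z) + m%:Z by rewrite /L; lia.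
  rewrite future; last by lia.
  by rewrite !val_qJ -past ?addrK//; lia.
have [i2|i2] := ltP (m + J)%N%:Z i; last by rewrite pz//; lia.
rewrite -[i in RHS](subrK L%:Z) val_pL pz; last by rewrite /L; lia.
have -> : i - L%:Z = (i - m%:Z - J%:Z - J%:Z) - n%:Z by rewrite /L; lia.
rewrite past; last by lia.
by rewrite -val_qJ subrK -val_qJ subrK -future ?subrK//; lia.
Qed.

End Subshift.

(** * The metric of a subshift and transitivity *)

Section SubshiftMetric.
Variables (k : nat) (P : 'M[bool]_k) (R : realType) (rho : R).
Hypothesis rho_gt1 : 1 < rho.
Implicit Types (x y z w q : sft P).

Let rho_gt0 : 0 < rho. Proof. exact: lt_trans rho_gt1. Qed.

Lemma agree_maxP x y : x <> y -> agree x y (agree_max x y) /\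
  forall N, agree x y N -> (N <= agree_max x y)%N.
Proof.
move=> xy; rewrite /agree_max; case: xgetP => [N _ //|no_max].
have [i xi] : exists i, val x i <> val y i.
  by apply/existsNP => xyE; apply: xy; exact: sft_ext.
have ex : exists N, `[< agree x y N >] by exists 0%N; apply/asboolP.
have ub N : `[< agree x y N >] -> (N <= absz i)%N.
  by move=> /asboolP xyN; rewrite leqNgt; apply/negP => /xyN.
case: (ex_maxnP ex ub) => N /asboolP xyN N_max.
exfalso; apply: (no_max N); split => // N' xyN'; apply: N_max; exact/asboolP.
Qed.

Lemma sft_dist_ge0 x y : 0 <= sft_dist rho x y.
Proof.
by rewrite /sft_dist; case: asboolP => // _; rewrite invr_ge0 exprn_ge0 ?ltW.
Qed.

Lemma sft_dist_agree x y N : agree x y N -> sft_dist rho x y <= rho ^- N.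
Proof.
move=> xyN; rewrite /sft_dist; case: asboolP => [_|/agree_maxP[_ /(_ N xyN) ?]].
  by rewrite invr_ge0 exprn_ge0 ?ltW.
by rewrite lef_pV2 ?posrE ?exprn_gt0// ler_weXn2l// ltW.
Qed.

Lemma sft_distP x y :
  x = y \/ exists2 N, sft_dist rho x y = rho ^- N & agree x y N.
Proof.
have [->|xy] := pselect (x = y); [by left|right].
exists (agree_max x y); last by case: (agree_maxP xy).
by rewrite /sft_dist; case: asboolP.
Qed.

Lemma cylinder_open (s : 'I_k) :
  metric_open (sft_dist rho) [set x : sft P | val x 0 = s].
Proof.
move=> x /= xs; exists 1 => // y.
have [<-//|[[|N] -> xyN]] := sft_distP x y; first by rewrite expr0 invr1 ltxx.
by move=> _; rewrite -xs xyN.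
Qed.

Hypothesis sft_transitive :
  topologically_transitive (sft_dist rho) (@sft_shift k P).

Lemma sft_connect x y : exists z (n : nat),
  (forall i, i <= 0 -> val z i = val x i) /\
  (forall i, 0 <= i -> val z (i + n%:Z) = val y i).
Proof.
have [||n [_ [[w /= wx <-] wy]]] := sft_transitive
  (@cylinder_open (val x 0)) (@cylinder_open (val y 0)).
- by exists x.
- by exists y.
have {}wy : val (sft_translate n w) 0 = val y 0 by rewrite -iter_sft_shift.
have [a [ax aw]] := sft_glue (esym wx).
have [|b [ba b_y]] := @sft_glue _ _ (sft_translate n a) y.
  by rewrite -wy !sft_translateE aw.
exists (sft_translate (- n%:Z) b), n; split=> i i0; rewrite sft_translateE.
  by rewrite ba ?sft_translateE ?subrK ?ax//; lia.
by rewrite addrK b_y.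
Qed.

Lemma homoclinic_dense q x N : exists2 z, homoclinic q z & agree x z N.
Proof.
have [b [n [bq bx]]] := sft_connect q (sft_translate (- N%:Z) x).
have [c [m [cb cq]]] := sft_connect (sft_translate (n + (N + N))%N b) q.
have cbE i : i <= 0 -> val c i = val b (i + (n + (N + N))%N%:Z).
  by move=> i0; rewrite cb.
exists (sft_translate (- N%:Z) c).
  case; [exists (N + m)%N|exists (N + n)%N] => i;
    rewrite !sft_translateE /= => i0.
    by rewrite -cq; [congr (val c _)|]; lia.
  by rewrite cbE; [rewrite -bq; [congr (val b _)|]|]; lia.
move=> i iN; rewrite sft_translateE cbE; last by lia.
have -> : i - N%:Z + (n + (N + N))%N%:Z = i + N%:Z + n%:Z by lia.
by rewrite bx; [rewrite sft_translateE addrK|lia].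
Qed.

End SubshiftMetric.

Lemma dense_uclose_extension (R : realType) (T : metricType R) (k : nat)
    (P : 'M[bool]_k) (X : Type) (c r : R) (V : sft P -> (X -> T) -> Prop) :
  compact [set: T] -> 0 <= c -> 0 <= r < 1 ->
  (forall x N, exists z u, agree x z N /\ V z u) ->
  (forall x y u v N, V x u -> V y v -> agree x y N ->
    uclose (c * r ^+ N) u v) ->
  exists Phi : sft P -> X -> T, forall x z u N, V z u -> agree x z N ->
    uclose ((c + c / (1 - r)) * r ^+ N) u (Phi x).
Proof.
move=> T_compact c0 r01 V_dense V_close.
suff /choice[Phi PhiE] : forall x, exists Phi_x, forall z u N, V z u ->
    agree x z N -> uclose ((c + c / (1 - r)) * r ^+ N) u Phi_x by exists Phi.
move=> x; have /choice[zs /choice[us zusP]] := V_dense x.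
have zs_close N : uclose (c * r ^+ N) (us N) (us N.+1).
  have [[xzN VN] [xzSN VSN]] := (zusP N, zusP N.+1).
  apply: V_close VN VSN _; apply: (@agree_trans _ _ x); first exact: agree_sym.
  exact: agree_mono (leqnSn N) xzSN.
have [Phi_x us_close] := geometric_ucvg T_compact c0 r01 zs_close.
exists Phi_x => z u N Vu xz; have [xzN VN] := zusP N.
rewrite mulrDl; apply: uclose_trans (us_close N); apply: V_close Vu VN _.
by apply: (@agree_trans _ _ x) => //; exact: agree_sym.
Qed.

(** * Transfer maps of cocycles with the same periodic data *)

Section Cocycles.
Variables (R : realType) (G : metricGroupType R) (k : nat) (P : 'M[bool]_k).
Implicit Types (f g : sft P -> homeo G) (x p : sft P) (s : bool) (n m : nat).

Definition half_orbit f s x (i : nat) : homeo G :=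
  if s then f (sft_translate i x)
  else homeo_sym (f (sft_translate (- i.+1%:Z) x)).

Arguments half_orbit : simpl never.

Lemma half_orbit_translate f s n x i :
  half_orbit f s (sft_translate (time s n) x) i = half_orbit f s x (n + i).
Proof.
case: s; rewrite /half_orbit /= sft_translateD.
  by congr (f (sft_translate _ _)); lia.
by congr (homeo_sym (f (sft_translate _ _))); lia.
Qed.

Lemma cocycle_iterE f n x :
  cocycle_iter f n x = comp_seq (half_orbit f true x) n.
Proof. by elim: n => //= n ->; rewrite iter_sft_shift. Qed.

Lemma cocycle_iterD f n m x : cocycle_iter f (n + m) x =
  cocycle_iter f m (sft_translate n x) \o cocycle_iter f n x.
Proof.
rewrite !cocycle_iterE comp_seqD /=; congr (homeo_fun (comp_seq _ m) \o _).
by apply/funext => i; rewrite -(half_orbit_translate f true).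
Qed.

Lemma homeo_inv_comp_seq_past f n x :
  homeo_inv (comp_seq (half_orbit f false x) n) =
  cocycle_iter f n (sft_translate (- n%:Z) x).
Proof.
elim: n => [//|n IH]; rewrite -[in RHS]add1n cocycle_iterD /= IH.
rewrite /half_orbit sft_translateD.
by congr (cocycle_iter f n (sft_translate _ x) \o _); lia.
Qed.

Definition same_periodic_data f g := forall n x, (1 <= n)%N ->
  iter n (@sft_shift k P) x = x -> cocycle_iter f n x = cocycle_iter g n x.

(* From [n] steps before [p], the products of [f] and [g] once around the
   periodic orbit agree. *)
Lemma holo_past_future f g p n m : same_periodic_data f g ->
  sft_translate (n + m)%N p = p ->
  holo (half_orbit f false p) (half_orbit g false p) n =
  holo (half_orbit f true p) (half_orbit g true p) m.
Proof.
move=> fg pnm; have : cocycle_iter f (n + m) (sft_translate (- n%:Z) p) =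
    cocycle_iter g (n + m) (sft_translate (- n%:Z) p).
  have [->//|nm] := posnP (n + m); apply: fg => //.
  by rewrite iter_sft_shift sft_translateD addrC -sft_translateD pnm.
rewrite !cocycle_iterD -!homeo_inv_comp_seq_past !sft_translateD subrr.
rewrite sft_translate0 !cocycle_iterE => fg_loop; apply/funext => r.
have /= := congr1 (@^~ (comp_seq (half_orbit g false p) n r)) fg_loop.
by rewrite homeo_funK /holo /= => <-; rewrite homeo_funK.
Qed.

End Cocycles.

Section Transfers.
Variables (R : realType) (G : metricGroupType R) (k : nat) (P : 'M[bool]_k).
Variables (M t C : R).
Hypotheses (M_gt1 : 1 < M) (t_gt0 : 0 < t) (Mt_lt1 : M * t < 1).
Hypothesis C_ge0 : 0 <= C.
Implicit Types (f g : sft P -> homeo G) (x y z p : sft P) (s : bool).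
Implicit Types (i n m N J : nat) (u v h : G -> G).

Let M_gt0 : 0 < M. Proof. exact: lt_trans M_gt1. Qed.
Let t_lt1 : t < 1. Proof. by apply: lt_trans Mt_lt1; rewrite ltr_pMl. Qed.
Let CM_ge0 : 0 <= C * M. Proof. by rewrite mulr_ge0// ltW. Qed.

Definition regular_cocycle f := (forall x, bilip M (f x)) /\
  forall x y N, agree x y N -> uclose (C * t ^+ N) (f x) (f y).

Definition matched f g :=
  [/\ regular_cocycle f, regular_cocycle g & same_periodic_data f g].

Lemma matched_sym f g : matched f g -> matched g f.
Proof. by case=> f_reg g_reg fg; split=> // n x n1 nx; rewrite fg. Qed.

Lemma regular_cocycle_ucvg f x (zs : nat -> sft P) : regular_cocycle f ->
  (forall N, agree x (zs N) N) ->
  ucvg (fun N => f (zs N)) (f x) /\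
  ucvg (fun N => homeo_inv (f (zs N))) (homeo_inv (f x)).
Proof.
move=> [fM f_close] xzs; have t01 : 0 <= t < 1 by rewrite ltW.
have zsx N : uclose (C * t ^+ N) (f (zs N)) (f x).
  by apply: uclose_sym; exact: f_close.
split; first exact: ucvg_geometric t01 zsx.
apply: (ucvg_geometric (c := M * C) t01) => N; rewrite -mulrA.
exact: uclose_homeo_inv (ltW M_gt0) (fM _) (zsx N).
Qed.

Lemma bilip_half_orbit f s x i : regular_cocycle f ->
  bilip M (half_orbit f s x i).
Proof.
case=> fM _; case: s; first exact: fM.
by have [] := fM (sft_translate (- i.+1%:Z) x).
Qed.

Lemma half_orbit_uclose f s x y i K : regular_cocycle f ->
  (forall j : int, i%:Z - K%:Z < time s j <= i%:Z + K%:Z ->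
    val x j = val y j) ->
  uclose (C * M * t ^+ K) (half_orbit f s x i) (half_orbit f s y i).
Proof.
move=> [fM f_close] xy; case: s xy => /= xy.
  apply: uclose_le (f_close _ _ K _) => [|j jK]; last by apply: xy; lia.
  by rewrite ler_wpM2r ?exprn_ge0 ?(ltW t_gt0)// ler_peMr// ltW.
rewrite mulrAC mulrC; apply: uclose_homeo_inv (ltW M_gt0) (fM _) _.
by apply: f_close => j jK; apply: xy; lia.
Qed.

Lemma half_orbit_half_agree f s N x y i :
  regular_cocycle f -> half_agree s N x y ->
  uclose (C * M * t ^+ N * t ^+ i) (half_orbit f s x i) (half_orbit f s y i).
Proof.
move=> f_reg xy; rewrite -mulrA -exprD; apply: half_orbit_uclose => // j jN.
by apply: xy; lia.
Qed.

Lemma half_orbit_agree f s x y r n i : regular_cocycle f ->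
  agree x y (r + n).+1 -> (i < n)%N ->
  uclose (C * M * t ^+ (r + (n - i))) (half_orbit f s x i) (half_orbit f s y i).
Proof.
move=> f_reg xy ni; apply: half_orbit_uclose => // j jn.
by apply: xy; case: s jn => /=; lia.
Qed.

Lemma near_half_orbit_holo_id n (d : R) : 0 < d ->
  \forall J \near \oo, forall f s z p, regular_cocycle f -> agree z p (J + J) ->
    uclose d (holo (half_orbit f s z) (half_orbit f s p) (n + J)) id.
Proof.
move=> d0; pose c := C * M * M / (1 - t) * (M ^+ (n + n.+1)).
have Mt01 : 0 <= M * t < 1 by rewrite mulr_ge0 ?ltW.
apply: filterS2 (nbhs_infty_gt n)
  (cvg_subnr n.+1 _ (geometric_near_le c Mt01 d0)).
move=> J nJ small f s z p f_reg zp; apply: uclose_le small _.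
have -> : c * (M * t) ^+ (J - n.+1) =
    C * M * M / (1 - t) * M ^+ (n + J) * t ^+ (J - n.+1).
  rewrite /c exprMn -!mulrA; do 4!congr (_ * _); rewrite mulrA -exprD.
  by congr (M ^+ _ * _); lia.
apply: holo_uclose_id => // i; first exact: bilip_half_orbit.
by move=> iJ; apply: half_orbit_agree => //; apply: agree_mono zp; lia.
Qed.

Variables (q : sft P) (l : nat).
Hypotheses (l_gt0 : (0 < l)%N) (q_periodic : sft_translate l q = q).
Hypothesis G_compact : compact [set: G].

(* The sequence converges along times in phase with [q], since there the
   products of [f] and [g] along [q] coincide. *)
Definition transfer f g s z n u := asymptotic q s z n /\
  ucvg (fun j => holo (half_orbit f s z) (half_orbit g s z) (n + j * l)) u.

Lemma cvg_return_times n : (fun j => n + j * l)%N @ \oo --> \oo.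
Proof.
apply: (@cvg_comp _ _ _ (muln^~ l) (addn n)); last exact: cvg_addnl.
exact: cvg_mulnr.
Qed.

Lemma transfer_periodic_point f g s : same_periodic_data f g ->
  transfer f g s q 0 id.
Proof.
move=> fg; split.
  by case: s; rewrite /asymptotic /= ?oppr0 sft_translate0.
suff holo_return j :
    holo (half_orbit f s q) (half_orbit g s q) (0 + j * l) = id.
  by under eq_fun do rewrite holo_return; exact: ucvg_cst.
rewrite add0n; have ql := sft_translate_muln j q_periodic.
case: s; first by rewrite -(@holo_past_future _ _ _ _ _ _ _ 0)// holo_id.
by rewrite (@holo_past_future _ _ _ _ _ _ _ _ 0) ?addn0.
Qed.

Lemma transfer_translate f g s z n m u : regular_cocycle f ->
  transfer f g s (sft_translate (time s n) z) m u ->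
  transfer f g s z (n + m) (homeo_inv (comp_seq (half_orbit f s z) n) \o u
    \o comp_seq (half_orbit g s z) n).
Proof.
move=> f_reg [zm zu]; split.
  move: zm; rewrite /asymptotic sft_translateD.
  by congr (half_agree _ _ (sft_translate _ _) _); case: (s) => /=; lia.
have half_orbitE f' : half_orbit f' s (sft_translate (time s n) z) =
    fun i => half_orbit f' s z (n + i)%N.
  by apply/funext => i; rewrite half_orbit_translate.
rewrite !half_orbitE in zu; under eq_fun do rewrite -addnA holoD.
have [_ inv_lip] :=
  bilip_comp_seq n (ltW M_gt0) (fun i => bilip_half_orbit s z i f_reg).
have Mn0 : 0 <= M ^+ n by rewrite exprn_ge0 ?ltW.
apply: ucvg_compr.
apply: (ucvg_comp (F := [set w | lip_with (M ^+ n) w])) => //.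
  exact: equi_holder_lip Mn0 _.
exact: ucvg_cst.
Qed.

Lemma transfer_half_agree (F : set (G -> G)) f g s N x y n u :
  regular_cocycle f -> regular_cocycle g -> equi_holder F -> F u ->
  half_agree s N x y -> transfer f g s x n u ->
  exists h h', [/\ holonomies M t (C * M * t ^+ N) h,
    holonomies M t (C * M * t ^+ N) h' & transfer f g s y n (h \o (u \o h'))].
Proof.
move=> f_reg g_reg F_holder Fu xy [xn xu].
have c0 : 0 <= C * M * t ^+ N by rewrite mulr_ge0 ?exprn_ge0 ?(ltW t_gt0).
have [h h_hol yx_h] := holo_ucvg M_gt1 t_gt0 Mt_lt1 G_compact c0
  (fun i => bilip_half_orbit s y i f_reg)
  (fun i => bilip_half_orbit s x i f_reg)
  (fun i => half_orbit_half_agree i f_reg (half_agree_sym xy)).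
have [h' h'_hol xy_h'] := holo_ucvg M_gt1 t_gt0 Mt_lt1 G_compact c0
  (fun i => bilip_half_orbit s x i g_reg)
  (fun i => bilip_half_orbit s y i g_reg)
  (fun i => half_orbit_half_agree i g_reg xy).
exists h, h'; split=> //; split.
  by apply: asymptotic_half_agree xn; exact: half_agree_mono xy.
have hol_holder := equi_holder_holonomies M_gt1 t_gt0 Mt_lt1 G_compact c0.
have times := cvg_return_times n.
under eq_fun do rewrite -(holo_comp (half_orbit f s x))
  -(holo_comp (half_orbit g s x) (half_orbit f s x)).
apply: (ucvg_comp hol_holder h_hol (ucvg_subseq times yx_h)).
exact: (ucvg_comp F_holder Fu xu (ucvg_subseq times xy_h')).
Qed.

Lemma transfer_factor f g s z n : matched f g -> asymptotic q s z n ->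
  exists h h', [/\ holonomies M t (C * M) h, holonomies M t (C * M) h' &
    transfer f g s z n (homeo_inv (comp_seq (half_orbit f s z) n) \o (h \o h')
      \o comp_seq (half_orbit g s z) n)].
Proof.
move=> [f_reg g_reg fg] zn.
have id_holder : equi_holder [set id : G -> G].
  by apply: equi_holder_lip ler01 _ => _ -> p r; rewrite mul1r.
have [h [h' []]] := transfer_half_agree f_reg g_reg id_holder (erefl : _ id)
  (half_agree_sym zn) (transfer_periodic_point s fg).
rewrite expr0 mulr1 => h_hol h'_hol /(transfer_translate f_reg).
by rewrite addn0; exists h, h'.
Qed.

Lemma transfer_exists f g s z n : matched f g -> asymptotic q s z n ->
  exists u, transfer f g s z n u.
Proof.
by move=> fg /(transfer_factor fg) [h [h' [_ _ zu]]]; eexists; exact: zu.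
Qed.

Definition transfers_at n := [set u | exists f g s z,
  matched f g /\ transfer f g s z n u].

Lemma equi_holder_transfers_at n : equi_holder (transfers_at n).
Proof.
have Mn0 : 0 <= M ^+ n by rewrite exprn_ge0 ?ltW.
have lip_holder : equi_holder [set w : G -> G | lip_with (M ^+ n) w].
  exact: equi_holder_lip Mn0 _.
have hol_holder := equi_holder_holonomies M_gt1 t_gt0 Mt_lt1 G_compact CM_ge0.
apply: equi_holder_sub (equi_holder_comp
  (equi_holder_comp lip_holder (equi_holder_comp hol_holder hol_holder))
  lip_holder) => u [f [g [s [z [fg [zn zu]]]]]].
have [h [h' [h_hol h'_hol [_ zv]]]] := transfer_factor fg zn.
rewrite (ucvg_unique zu zv); have [f_reg g_reg _] := fg.
have [_ fn_lip] :=
  bilip_comp_seq n (ltW M_gt0) (fun i => bilip_half_orbit s z i f_reg).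
have [gn_lip _] :=
  bilip_comp_seq n (ltW M_gt0) (fun i => bilip_half_orbit s z i g_reg).
exists (homeo_inv (comp_seq (half_orbit f s z) n) \o (h \o h')).
  exists (homeo_inv (comp_seq (half_orbit f s z) n)) => //.
  by exists (h \o h') => //; exists h => //; exists h'.
by exists (comp_seq (half_orbit g s z) n : G -> G).
Qed.

(* Closing up the orbit of [z] far out gives periodic points [p], where the
   products of [f] and [g] around the orbit agree. *)
Lemma transfer_past_future f g z n m u v : matched f g ->
  transfer f g false z n u -> transfer f g true z m v -> u = v.
Proof.
move=> fg zu zv; have [[zn cvg_u] [zm cvg_v]] := (zu, zv).
have [f_reg g_reg fg_per] := fg.
have v_m : transfers_at m v by exists f, g, true, z.
apply: (ucvg_conj_eq (equi_holder_transfers_at m) v_m cvg_u cvg_v) => d d0.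
have d2 : 0 < d / 2 by rewrite divr_gt0.
have near_return r : \forall j \near \oo, forall f' s x p,
    regular_cocycle f' -> agree x p (j * l + j * l) -> uclose (d / 2)
      (holo (half_orbit f' s x) (half_orbit f' s p) (r + j * l)) id.
  exact: cvg_mulnr l_gt0 _ (near_half_orbit_holo_id r d2).
apply: filterS3 (nbhs_infty_gt 0) (near_return n) (near_return m).
move=> j j0 small_n small_m.
have J0 : (0 < j * l)%N by rewrite muln_gt0 j0.
have qJ := sft_translate_muln j q_periodic.
have [p [pL zp]] := homoclinic_closing J0 qJ zn zm.
set J := (j * l)%N in small_n small_m pL zp *; have pz := agree_sym zp.
pose ho f' s x := half_orbit f' s x.
exists (holo (ho f false z) (ho f false p) (n + J)
  \o holo (ho f true p) (ho f true z) (m + J)).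
exists (holo (ho g true z) (ho g true p) (m + J)
  \o holo (ho g false p) (ho g false z) (n + J)).
split.
- exact: holo_conj (holo_past_future fg_per pL).
- rewrite [d]splitr; apply: uclose_trans (small_m _ _ _ _ f_reg pz).
  exact: uclose_compr (small_n _ _ _ _ f_reg zp).
- rewrite [d]splitr; apply: uclose_trans (small_n _ _ _ _ g_reg pz).
  exact: uclose_compr (small_m _ _ _ _ g_reg zp).
Qed.

Lemma transfer_unique f g s s' z n n' u v : matched f g -> homoclinic q z ->
  transfer f g s z n u -> transfer f g s' z n' v -> u = v.
Proof.
move=> fg z_hom.
have [m /(transfer_exists fg) [w zw]] := z_hom true.
have [m' /(transfer_exists fg) [w' zw']] := z_hom false.
have ww' := transfer_past_future fg zw' zw.
have eq_w s0 n0 u0 : transfer f g s0 z n0 u0 -> u0 = w.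
  case: s0 => zu0; last exact: transfer_past_future fg zu0 zw.
  by rewrite -ww' (transfer_past_future fg zw' zu0).
by move=> /eq_w -> /eq_w ->.
Qed.

Definition homoclinic_transfer f g z u :=
  homoclinic q z /\ exists s n, transfer f g s z n u.

Lemma homoclinic_transfer_exists f g z : matched f g -> homoclinic q z ->
  exists u, homoclinic_transfer f g z u.
Proof.
move=> fg z_hom; have [n zn] := z_hom true.
have [u zu] := transfer_exists fg zn.
by exists u; split=> //; exists true, n.
Qed.

Lemma homoclinic_transfer_unique f g z u v : matched f g ->
  homoclinic_transfer f g z u -> homoclinic_transfer f g z v -> u = v.
Proof.
move=> fg [z_hom [s [n zu]]] [_ [s' [n' zv]]].
exact: transfer_unique fg z_hom zu zv.
Qed.

Lemma homoclinic_transfer_direction f g s z u : matched f g ->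
  homoclinic_transfer f g z u -> exists n, transfer f g s z n u.
Proof.
move=> fg [z_hom zu]; have [n zn] := z_hom s; exists n.
have [v zv] := transfer_exists fg zn.
rewrite (@homoclinic_transfer_unique f g z u v)//; split=> //.
by exists s, n.
Qed.

Lemma homoclinic_transferK f g z u v : matched f g ->
  homoclinic_transfer f g z u -> homoclinic_transfer g f z v -> u \o v = id.
Proof.
move=> fg zu /(homoclinic_transfer_direction true (matched_sym fg)) [n [zn zv]].
have z_hom := zu.1.
have [w [_ zw]] := transfer_exists fg zn.
have -> : u = w.
  by apply: (homoclinic_transfer_unique fg zu); split=> //; exists true, n.
have w_n : transfers_at n w by exists f, g, true, z.
have w_holder := equi_holder_transfers_at n.
apply: ucvg_unique (ucvg_comp w_holder w_n zw zv) _.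
by under eq_fun do rewrite holo_comp holo_id; exact: ucvg_cst.
Qed.

Lemma homoclinic_transfer_translate1 f g z u : matched f g ->
  homoclinic_transfer f g z u ->
  homoclinic_transfer f g (sft_translate 1 z) (f z \o u \o homeo_inv (g z)).
Proof.
move=> fg zu; split; first exact: homoclinic_translate1 l_gt0 q_periodic zu.1.
have [n] := homoclinic_transfer_direction false fg zu; exists false, n.+1.
have [f_reg _ _] := fg; have z1 : sft_translate (- 1) (sft_translate 1 z) = z.
  by rewrite sft_translateD addNr sft_translate0.
have := @transfer_translate f g false (sft_translate 1 z) 1 n u f_reg.
by rewrite /= /half_orbit z1; apply.
Qed.

Lemma homoclinic_transfer_half_agree f g s N x y u v : matched f g ->
  homoclinic_transfer f g x u -> homoclinic_transfer f g y v ->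
  half_agree s N x y ->
  exists h h', [/\ holonomies M t (C * M * t ^+ N) h,
    holonomies M t (C * M * t ^+ N) h' & v = h \o (u \o h')].
Proof.
move=> fg xu yv xy; have [f_reg g_reg _] := fg.
have [n xnu] := homoclinic_transfer_direction s fg xu.
have u_n : transfers_at n u by exists f, g, s, x.
have u_holder := equi_holder_transfers_at n.
have [h [h' [h_hol h'_hol yhuh']]] :=
  transfer_half_agree f_reg g_reg u_holder u_n xy xnu.
exists h, h'; split=> //; apply: (homoclinic_transfer_unique fg yv).
by split; [exact: yv.1|exists s, n].
Qed.

Definition homoclinic_transfers := [set u | exists f g z,
  matched f g /\ homoclinic_transfer f g z u].

Hypothesis q_dense : forall x N, exists2 z, homoclinic q z & agree x z N.

(* The transfer map at [z] is that at a point chosen for the symbol [z_0],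
   composed with holonomies through the point with the past of the latter and
   the future of [z]. *)
Lemma equi_holder_homoclinic_transfers : equi_holder homoclinic_transfers.
Proof.
have /choice[ref refP] : forall a : 'I_k, exists n, forall z, val z 0 = a ->
    exists x, [/\ val x 0 = a, homoclinic q x & asymptotic q true x n].
  move=> a; have [[z za]|no_a] := pselect (exists z : sft P, val z 0 = a);
    last by exists 0%N => z za; exfalso; apply: no_a; exists z.
  have [x x_hom zx] := q_dense z 1; have [n xn] := x_hom true.
  by exists n => _ _; exists x; split=> //; rewrite -za zx.
have hol_holder := equi_holder_holonomies M_gt1 t_gt0 Mt_lt1 G_compact CM_ge0.
have ref_holder : equi_holder (\bigcup_a transfers_at (ref a)).
  apply: equi_holder_bigcup => [|a]; first exact: compact_finite_diameter.
  exact: equi_holder_transfers_at.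
apply: equi_holder_sub (equi_holder_comp hol_holder (equi_holder_comp
  (equi_holder_comp hol_holder (equi_holder_comp ref_holder hol_holder))
  hol_holder)) => u [f [g [z [fg zu]]]].
have [x [xz x_hom xn]] := refP _ z erefl.
have [|y [xy zy]] := @half_agree_bracket _ _ x z 0; first by move=> [[|i]|i].
have xy0 := half_agree_mono (leq0n 1) xy.
have zy0 := half_agree_mono (leq0n 1) zy.
have [v xv] := transfer_exists fg xn.
have xv_hom : homoclinic_transfer f g x v.
  by split=> //; exists true, (ref (val z 0)).
have y_hom := homoclinic_bracket xy0 zy0 x_hom zu.1.
have [w yw] := homoclinic_transfer_exists fg y_hom.
have [past [past' []]] := homoclinic_transfer_half_agree fg xv_hom yw xy0.
have [future [future' []]] :=
  homoclinic_transfer_half_agree fg yw zu (half_agree_sym zy0).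
rewrite expr0 mulr1 => future_hol future'_hol -> past_hol past'_hol ->.
exists future => //; exists (past \o (v \o past') \o future') => //.
exists (past \o (v \o past')); last by exists future'.
exists past => //; exists (v \o past') => //; exists v; last by exists past'.
by exists (val z 0) => //; exists f, g, true, x.
Qed.

Definition extends_transfers (c r : R) f g (Phi : sft P -> G -> G) :=
  forall x z u N, homoclinic_transfer f g z u -> agree x z N ->
    uclose (c * r ^+ N) u (Phi x).

Section UniformModulus.
Variables A b : R.
Hypotheses (A_ge0 : 0 <= A) (b_gt0 : 0 < b) (b_le1 : b <= 1).
Hypothesis transfers_holder :
  forall u, homoclinic_transfers u -> holder_with A b u.

Let r := t `^ b.
Let r01 : 0 <= r < 1. Proof. by rewrite powR_ge0 powR_lt1 ?t_gt0. Qed.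
Let K := C * M * M / (1 - M * t).
Let K_ge0 : 0 <= K.
Proof. by rewrite divr_ge0 ?subr_ge0 ?(ltW Mt_lt1)// mulr_ge0 ?(ltW M_gt0). Qed.

Lemma homoclinic_transfer_half_agree_uclose f g s N x y u v : matched f g ->
  homoclinic_transfer f g x u -> homoclinic_transfer f g y v ->
  half_agree s N x y -> uclose ((K + A * K `^ b) * r ^+ N) u v.
Proof.
move=> fg xu yv xy; apply: uclose_sym.
have [h [h' [h_hol h'_hol ->]]] := homoclinic_transfer_half_agree fg xu yv xy.
have KtN : C * M * t ^+ N * M / (1 - M * t) = K * t ^+ N by rewrite /K; ring.
have := holonomies_uclose_id h_hol; have := holonomies_uclose_id h'_hol.
rewrite !KtN => h'_id h_id; have u_holder : holder_with A b u.
  by apply: transfers_holder; exists f, g, x.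
apply: uclose_le (uclose_trans (uclose_compr (u \o h') h_id)
  (holder_with_uclose A_ge0 (ltW b_gt0) u_holder h'_id)).
have t_ge0 := ltW t_gt0; rewrite powRM ?exprn_ge0// powR_exprn// mulrDl mulrA.
rewrite lerD2r ler_wpM2l// lerXn2r ?nnegrE ?powR_ge0//.
by rewrite ger1_powR// t_gt0 ltW.
Qed.

Lemma homoclinic_transfer_uclose : exists2 c : R, 0 <= c &
  forall f g x y u v N, matched f g -> homoclinic_transfer f g x u ->
    homoclinic_transfer f g y v -> agree x y N -> uclose (c * r ^+ N) u v.
Proof.
have [D diamG] := compact_finite_diameter G_compact.
pose c := K + A * K `^ b.
have c0 : 0 <= c by apply: addr_ge0 K_ge0 _; rewrite mulr_ge0 ?powR_ge0.
exists (Num.max 0 D + (c + c)) => [|f g x y u v [|N] fg xu yv xy].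
- by apply: addr_ge0; [rewrite le_max lexx|exact: addr_ge0].
- move=> p; apply: (le_trans (diamG _ _)); rewrite expr0 mulr1.
  by apply: ler_wpDr; [exact: addr_ge0|rewrite le_max lexx orbT].
have [z [xz yz]] := half_agree_bracket xy.
have z_hom := homoclinic_bracket (half_agree_mono (leq0n _) xz)
  (half_agree_mono (leq0n _) yz) xu.1 yv.1.
have [w zw] := homoclinic_transfer_exists fg z_hom.
have uw := homoclinic_transfer_half_agree_uclose fg xu zw xz.
have vw := homoclinic_transfer_half_agree_uclose fg yv zw yz.
apply: uclose_le (uclose_trans uw (uclose_sym vw)).
by rewrite -mulrDl ler_wpM2r ?exprn_ge0 ?powR_ge0// lerDr le_max lexx.
Qed.

Lemma extends_transfers_exist : exists2 c : R, 0 <= c &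
  forall f g, matched f g -> exists Phi, extends_transfers c r f g Phi.
Proof.
have [c c0 close] := homoclinic_transfer_uclose.
have r1 : 0 <= 1 - r by case/andP: r01 => _ /ltW; rewrite subr_ge0.
exists (c + c / (1 - r)) => [|f g fg]; first by rewrite addr_ge0// divr_ge0.
apply: dense_uclose_extension => // [x N|x y u v N xu yv].
  have [z z_hom xz] := q_dense x N.
  by have [u zu] := homoclinic_transfer_exists fg z_hom; exists z, u.
exact: close fg xu yv.
Qed.

End UniformModulus.

Section Limits.
Variables c r : R.
Hypothesis r01 : 0 <= r < 1.
Implicit Types Phi Psi : sft P -> G -> G.

Lemma homoclinic_approx x :
  exists zs, forall N, homoclinic q (zs N) /\ agree x (zs N) N.+1.
Proof.
suff /choice[zs zsP] : forall N, exists z, homoclinic q z /\ agree x z N.+1.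
  by exists zs.
by move=> N; have [z z_hom xz] := q_dense x N.+1; exists z.
Qed.

Lemma extends_transfers_ucvg f g Phi x zs us : extends_transfers c r f g Phi ->
  (forall N, agree x (zs N) N) ->
  (forall N, homoclinic_transfer f g (zs N) (us N)) -> ucvg us (Phi x).
Proof.
by move=> PhiE xzs zus; apply: ucvg_geometric r01 _ => N; exact: PhiE.
Qed.

Lemma extends_transfers_approx f g Phi x zs : matched f g ->
  extends_transfers c r f g Phi ->
  (forall N, homoclinic q (zs N) /\ agree x (zs N) N.+1) ->
  exists2 us, forall N, homoclinic_transfer f g (zs N) (us N) & ucvg us (Phi x).
Proof.
move=> fg PhiE zsP.
have /choice[us zus] N := homoclinic_transfer_exists fg (zsP N).1.
exists us => //; apply: extends_transfers_ucvg PhiE _ zus => N.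
exact: agree_mono (leqnSn N) (zsP N).2.
Qed.

Lemma extends_transfers_holder A b f g Phi x :
  (forall u, homoclinic_transfers u -> holder_with A b u) ->
  matched f g -> extends_transfers c r f g Phi -> holder_with A b (Phi x).
Proof.
move=> transfersA fg PhiE; have [zs zsP] := homoclinic_approx x.
have [us zus us_cvg] := extends_transfers_approx fg PhiE zsP.
apply: (holder_with_ucvg us_cvg) => N.
by apply: transfersA; exists f, g, (zs N).
Qed.

Lemma extends_transfers_equi_holder f g Phi x : matched f g ->
  extends_transfers c r f g Phi -> equi_holder [set Phi x].
Proof.
move=> fg PhiE.
have [b [A [b0 b1 A0 transfersA]]] := equi_holder_homoclinic_transfers.
by exists b, A; split=> // _ ->; exact: extends_transfers_holder fg PhiE.
Qed.

Lemma extends_transfers_uclose f g Phi x y N : matched f g ->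
  extends_transfers c r f g Phi -> agree x y N ->
  uclose ((c + c) * r ^+ N) (Phi x) (Phi y).
Proof.
move=> fg PhiE xy; have [z z_hom yz] := q_dense y N.
have [u zu] := homoclinic_transfer_exists fg z_hom; rewrite mulrDl.
apply: uclose_trans (PhiE y z u N zu yz); apply: uclose_sym.
by apply: PhiE zu _; exact: agree_trans xy yz.
Qed.

Lemma extends_transfersK f g Phi Psi x : matched f g ->
  extends_transfers c r f g Phi -> extends_transfers c r g f Psi ->
  Phi x \o Psi x = id.
Proof.
move=> fg PhiE PsiE; have [zs zsP] := homoclinic_approx x.
have [us zus us_cvg] := extends_transfers_approx fg PhiE zsP.
have [vs zvs vs_cvg] := extends_transfers_approx (matched_sym fg) PsiE zsP.
have Phi_holder := extends_transfers_equi_holder x fg PhiE.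
apply: ucvg_unique (ucvg_comp Phi_holder erefl us_cvg vs_cvg) _.
under eq_fun => N do rewrite (homoclinic_transferK fg (zus N) (zvs N)).
exact: ucvg_cst.
Qed.

Lemma extends_transfers_equivariant f g Phi x : matched f g ->
  extends_transfers c r f g Phi ->
  Phi (sft_translate 1 x) = f x \o (Phi x \o homeo_inv (g x)).
Proof.
move=> fg PhiE; have [f_reg g_reg _] := fg.
have [zs zsP] := homoclinic_approx x.
have [us zus us_cvg] := extends_transfers_approx fg PhiE zsP.
have xzs N : agree x (zs N) N by exact: agree_mono (leqnSn N) (zsP N).2.
have [fzs _] := regular_cocycle_ucvg f_reg xzs.
have [_ gzs] := regular_cocycle_ucvg g_reg xzs.
have fx_holder : equi_holder [set f x : G -> G].
  by apply: equi_holder_lip (ltW M_gt0) _ => _ ->; case: f_reg => /(_ x) [].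
have Phi_holder := extends_transfers_equi_holder x fg PhiE.
apply: ucvg_unique (ucvg_comp fx_holder erefl fzs
  (ucvg_comp Phi_holder erefl us_cvg gzs)).
pose zs1 N := sft_translate 1 (zs N).
apply: (extends_transfers_ucvg PhiE (zs := zs1)) => N.
  exact: agree_translate1 (zsP N).2.
exact: homoclinic_transfer_translate1 fg (zus N).
Qed.

End Limits.

Lemma equi_holder_conjugacy f g : matched f g ->
  exists A b B : R, [/\ 0 <= A, 0 < b, b <= 1, 0 <= B &
  exists phi : sft P -> homeo G,
    [/\ forall x,
          holder_with A b (phi x) /\ holder_with A b (homeo_inv (phi x)),
        forall x y N, agree x y N ->
          uclose (B * (t `^ b) ^+ N) (phi x) (phi y) &
        forall x, f x = phi (sft_translate 1 x) \o g x \o homeo_inv (phi x)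
          :> (G -> G)]].
Proof.
move=> fg; have gf := matched_sym fg.
have [b [A [b0 b1 A0 transfersA]]] := equi_holder_homoclinic_transfers.
have r01 : 0 <= t `^ b < 1 by rewrite powR_ge0 powR_lt1 ?t_gt0.
have [c c0 extension] := extends_transfers_exist A0 b0 b1 transfersA.
have [[Phi PhiE] [Psi PsiE]] := (extension _ _ fg, extension _ _ gf).
have PhiA x := extends_transfers_holder r01 x transfersA fg PhiE.
have PsiA x := extends_transfers_holder r01 x transfersA gf PsiE.
have PhiK x := extends_transfersK r01 x fg PhiE PsiE.
have PsiK x := extends_transfersK r01 x gf PsiE PhiE.
have F_holder : equi_holder [set u : G -> G | holder_with A b u] by exists b, A.
pose phi x := @Homeo _ _ (Phi x) (Psi x) (fun a => congr1 (@^~ a) (PsiK x))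
  (fun a => congr1 (@^~ a) (PhiK x)) (equi_holder_continuous F_holder (PhiA x))
  (equi_holder_continuous F_holder (PsiA x)).
exists A, b, (c + c); split; rewrite ?addr_ge0//.
exists phi; split=> //= [x y N xy|x].
  exact: extends_transfers_uclose fg PhiE xy.
rewrite (extends_transfers_equivariant r01 x fg PhiE).
apply/funext => a /=.
by rewrite homeo_funK -[Phi x _]/((Phi x \o Psi x) a) PhiK.
Qed.

End Transfers.

(** * Domination and Hölder conjugacy *)

Section DominatedCocycles.
Variables (R : realType) (G : metricGroupType R) (k : nat) (P : 'M[bool]_k).
Variable rho : R.
Hypothesis rho_gt1 : 1 < rho.
Implicit Types (f g : sft P -> homeo G) (u v : G -> G) (alpha b A K M C : R).

Let rho_gt0 : 0 < rho. Proof. exact: lt_trans rho_gt1. Qed.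

Lemma lip_const_lt u K : (lip_const u < K%:E)%E -> lip_with K u.
Proof.
move=> /ereal_inf_lt [_ [K' [_ uK'] <-]]; rewrite lte_fin => /ltW KK'.
exact: lip_with_le KK' uK'.
Qed.

Lemma dist_lip_uclose u v K : (dist_lip u v <= K%:E)%E -> uclose K u v.
Proof.
move=> uvK p; rewrite -lee_fin; apply: le_trans uvK.
apply: (@le_trans _ _ (dist_sup u v)).
  by apply: ereal_sup_ubound; exists p.
apply: leeDl; apply: le_ereal_inf_tmp => _ [K' [K'0 _] <-].
by rewrite lee_fin.
Qed.

Lemma uclose_dist_sup u v K : uclose K u v -> (dist_sup u v <= K%:E)%E.
Proof. by move=> uv; apply: ge_ereal_sup => _ [p _ <-]; rewrite lee_fin. Qed.

Lemma holder_with_fibre A b u : holder_with A b u -> holder_fibre b u.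
Proof. by move=> uA; exists A => p p'; rewrite lee_fin. Qed.

Lemma regular_cocycle_le M M' t C C' f : 0 <= t -> M <= M' -> C <= C' ->
  regular_cocycle M t C f -> regular_cocycle M' t C' f.
Proof.
move=> t0 MM' CC' [fM f_close]; split=> [x|x y N xy].
  by have [fxM fxM'] := fM x; split; exact: lip_with_le MM' _.
by apply: uclose_le (f_close _ _ _ xy); rewrite ler_wpM2r// exprn_ge0.
Qed.

Lemma dominated_regular_cocycle alpha f : 0 < alpha ->
  holder_cocycle rho alpha f -> su_dominated rho alpha f ->
  exists theta C : R, [/\ 0 < theta, 0 <= C &
    regular_cocycle (rho `^ (alpha - theta)) (rho `^ (- alpha)) C f].
Proof.
move=> alpha0 [_ [C f_holder]] [theta theta0 f_dom].
exists theta, `|C|; split=> //; split=> [x|x y N xy].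
  by have [/lip_const_lt ? /lip_const_lt ?] := f_dom x.
apply: uclose_le (dist_lip_uclose (f_holder x y)).
have d0 := sft_dist_ge0 rho_gt1 x y; have dN := sft_dist_agree rho_gt1 xy.
rewrite -powR_exprVn ?(ltW rho_gt0)//.
apply: (@le_trans _ _ (`|C| * sft_dist rho x y `^ alpha)).
  by rewrite ler_wpM2r ?powR_ge0// ler_norm.
by rewrite ler_wpM2l// le_powR2r// ltW.
Qed.

Lemma dominated_matched alpha f g : 0 < alpha ->
  holder_cocycle rho alpha f -> su_dominated rho alpha f ->
  holder_cocycle rho alpha g -> su_dominated rho alpha g ->
  same_periodic_data f g ->
  exists M C : R, [/\ 1 < M, M * rho `^ (- alpha) < 1, 0 <= C &
    matched M (rho `^ (- alpha)) C f g].
Proof.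
move=> alpha0 f_holder f_dom g_holder g_dom fg.
have [tf [Cf [tf0 Cf0 f_reg]]] :=
  dominated_regular_cocycle alpha0 f_holder f_dom.
have [tg [Cg [tg0 Cg0 g_reg]]] :=
  dominated_regular_cocycle alpha0 g_holder g_dom.
pose theta := Num.min (alpha / 2) (Num.min tf tg).
have theta0 : 0 < theta by rewrite !lt_min tf0 tg0 divr_gt0.
have theta_le : theta <= alpha / 2 by rewrite ge_min lexx.
have le_pow theta' : theta <= theta' ->
    rho `^ (alpha - theta') <= rho `^ (alpha - theta).
  by move=> tt'; rewrite ler_powR ?(ltW rho_gt1)// lerD2l lerN2.
exists (rho `^ (alpha - theta)), (Cf + Cg); split; rewrite ?addr_ge0//.
- by apply: powR_gt1 => //; lra.
- rewrite -powRD ?(gt_eqF rho_gt0) ?implybT// addrAC subrr sub0r.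
  by rewrite powRN invf_lt1 ?powR_gt0// powR_gt1.
split=> //.
  apply: regular_cocycle_le f_reg; rewrite ?powR_ge0 ?lerDl//.
  by rewrite le_pow// !ge_min lexx orbT.
apply: regular_cocycle_le g_reg; rewrite ?powR_ge0 ?lerDr//.
by rewrite le_pow// !ge_min lexx !orbT.
Qed.

Lemma agree_uclose_holder alpha beta b B (phi : sft P -> homeo G) :
  0 <= B -> beta <= b * alpha ->
  (forall x y N, agree x y N ->
     uclose (B * ((rho `^ (- alpha)) `^ b) ^+ N) (phi x) (phi y)) ->
  holder (sft_dist rho) (fun u v : homeo G => dist_sup u v) beta phi.
Proof.
move=> B0 beta_le phi_close; exists B => x y; apply: uclose_dist_sup.
have [<-|[N -> xy]] := sft_distP rho x y.
  by apply: uclose_le (uclose_refl _); rewrite mulr_ge0 ?powR_ge0.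
apply: uclose_le (phi_close x y N xy); rewrite ler_wpM2l//.
rewrite -powRrM mulNr mulrC -powR_exprVn ?(ltW rho_gt0)//.
apply: ger_powR => //.
by rewrite invr_gt0 exprn_gt0//= invf_le1 ?exprn_gt0// exprn_ege1// ltW.
Qed.

Lemma dominated_conjugacy alpha f g : compact [set: G] ->
  topologically_transitive (sft_dist rho) (@sft_shift k P) ->
  sft P -> 0 < alpha ->
  holder_cocycle rho alpha f -> su_dominated rho alpha f ->
  holder_cocycle rho alpha g -> su_dominated rho alpha g ->
  same_periodic_data f g ->
  exists2 b : R, 0 < b <= 1 & exists phi : sft P -> homeo G,
    [/\ forall beta x, 0 < beta <= b -> holder_homeo beta (phi x),
        forall beta, beta <= b * alpha ->
          holder (sft_dist rho) (fun u v : homeo G => dist_sup u v) beta phi &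
        forall x, f x = phi (sft_shift x) \o g x \o homeo_inv (phi x)
          :> (G -> G)].
Proof.
move=> G_compact transitive x0 alpha0 f_holder f_dom g_holder g_dom fg_per.
have [q [l [l_gt0 q_periodic]]] := sft_periodic_point x0.
have q_dense := homoclinic_dense rho_gt1 transitive q.
have [M [C [M_gt1 Mt_lt1 C_ge0 fg]]] :=
  dominated_matched alpha0 f_holder f_dom g_holder g_dom fg_per.
have t_gt0 : 0 < rho `^ (- alpha) by rewrite powR_gt0.
have [A [b [B [A0 b0 b1 B0 [phi [phi_holder phi_close phiE]]]]]] :=
  equi_holder_conjugacy M_gt1 t_gt0 Mt_lt1 C_ge0 l_gt0 q_periodic G_compact
    q_dense fg.
have [D _ lower_exponent] :=
  finite_diameter_holder_exponent G (compact_finite_diameter G_compact).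
exists b; first by rewrite b0.
exists phi; split=> [beta x /andP[beta0 beta_b]|beta beta_le|x].
- have [phiA phiA'] := phi_holder x.
  have lower u := lower_exponent A b beta u A0 beta0 beta_b b1.
  by split; apply: holder_with_fibre; exact: lower.
- exact: agree_uclose_holder B0 beta_le phi_close.
- by rewrite phiE sft_shiftE.
Qed.

End DominatedCocycles.

Theorem theorem1 (R : realType) (G : metricGroupType R)
  (G_compact : compact [set: G])
  (k : nat) (P : 'M[bool]_k)
  (P_rows : forall i : 'I_k, exists j : 'I_k, P i j)
  (rho : R) (rho_gt1 : 1 < rho)
  (transitive : topologically_transitive (sft_dist rho) (@sft_shift k P))
  (alpha : R) (alpha_gt0 : 0 < alpha) (alpha_le1 : alpha <= 1)
  (f g : sft P -> homeo G)
  (f_holder : holder_cocycle rho alpha f)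
  (g_holder : holder_cocycle rho alpha g)
  (f_dominated : su_dominated rho alpha f)
  (g_dominated : su_dominated rho alpha g)
  (periodic_data : forall (n : nat) (x0 : sft P), (1 <= n)%N ->
    iter n (@sft_shift k P) x0 = x0 ->
    cocycle_iter f n x0 = cocycle_iter g n x0) :
  exists beta : R, [/\ 0 < beta, beta < alpha ^+ 2 &
    exists phi : sft P -> homeo G,
      [/\ forall x, holder_homeo beta (phi x),
          holder (sft_dist rho) (fun u v : homeo G => dist_sup u v) beta phi &
          forall x, homeo_fun (f x) =
            homeo_fun (phi (sft_shift x)) \o homeo_fun (g x)
              \o homeo_inv (phi x)]].
Proof.
have alpha2_gt0 : 0 < alpha ^+ 2 / 2 by rewrite divr_gt0 ?exprn_gt0.
have alpha2_lt : alpha ^+ 2 / 2 < alpha ^+ 2.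
  by rewrite ltr_pdivrMr// ltr_pMr ?exprn_gt0// ltr1n.
have [[x0 _]|no_point] := pselect (exists x : sft P, True); last first.
  exists (alpha ^+ 2 / 2); split=> //; exists f.
  by split=> [x||x]; [|exists 0 => x|]; exfalso; apply: no_point; exists x.
have [b /andP[b0 b1] [phi [phi_fibre phi_base phiE]]] :=
  dominated_conjugacy rho_gt1 G_compact transitive x0 alpha_gt0
    f_holder f_dominated g_holder g_dominated periodic_data.
pose beta := Num.min (b * alpha) (alpha ^+ 2 / 2).
have beta_gt0 : 0 < beta by rewrite lt_min mulr_gt0.
have beta_le : beta <= b * alpha by rewrite ge_min lexx.
exists beta; split=> //.
  by apply: le_lt_trans alpha2_lt; rewrite ge_min lexx orbT.
exists phi; split=> // [x|]; last exact: phi_base.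
by apply: phi_fibre; rewrite beta_gt0 (le_trans beta_le)// ler_piMr// ltW.
Qed.
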